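(* Let $\mathbf{k}$ be a field and let $\mathcal{M}$ be a realizable (essential) matroid over $\mathbb{Z}$ on the ground set $[n]$ of rank $r$. Then the Hilbert series of its face module satisfies \[ \operatorname{Hilb}(\mathbf{k}[\mathcal{M}],t)=\frac{t^{r}}{(1-t)^{r}}\,T_{\mathcal{M}^*}(1,1/t). \]
   Context: A matroid over $\mathbb{Z}$ on $[n]$ assigns to each $A\subseteq[n]$ a finitely generated abelian group $\mathcal{M}(A)$ (up to isomorphism), subject to the Fink–Moci patching condition; it is assumed essential (no nonzero free direct summand of $\mathcal{M}([n])$). It is realizable if there are $z_1,\dots,z_n\in\mathcal{M}(\emptyset)$ with $\mathcal{M}(A)=\mathcal{M}(\emptyset)/(z_i:i\in A)$; fix such a realization. Write $\mathcal{M}(A)\cong\mathbb{Z}^{d(A)}\times G_A$ with $G_A$ finite, $m(A)=\#G_A$, $\operatorname{cork}(A)=d(\emptyset)-d(A)$, $r=\operatorname{cork}([n])$ the rank, and $C_A=\operatorname{Hom}(G_A,\mathbb{C}^* )$. For $b\notin A$, $\pi_{(A,b)}:\mathcal{M}(A)\to\mathcal{M}(A\cup\{b\})$ is the quotient by the image of $z_b$, and $\pi^{(A,b)}:C_{A\cup\{b\}}\to C_A$ is $h\mapsto h\circ\pi_{(A,b)}|_{G_A}$. The poset of torsions $\operatorname{Gr}\mathcal{M}$ consists of pairs $(A,l)$ with $d(\emptyset)-d(A)=\#A$, $l\in C_A$, ordered by the reflexive–transitive closure of the covering relation: $(A\cup\{b\},h)$ covers $(A,l)$ iff $\pi^{(A,b)}(h)=l$.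 For a simplicial poset $P$ (unique minimum $\hat0$, every lower interval $[\hat0,\sigma]$ Boolean, with rank $\operatorname{rk}\sigma$ its length), the face ring is $\mathbf{k}[P]=\mathbf{k}[x_\sigma:\sigma\in P]/I_P$, where $\deg x_\sigma=\operatorname{rk}\sigma$ and $I_P$ is generated by $x_{\hat0}-1$ and $x_\sigma x_\tau-x_{\sigma\wedge\tau}\sum_{\gamma\in\sigma\vee\tau}x_\gamma$ for all $\sigma,\tau\in P$ ($\sigma\wedge\tau$ the unique greatest lower bound, $\sigma\vee\tau$ the set of minimal common upper bounds, an empty sum being $0$). Let $\mathcal{M}'$ be the realizable matroid with $\mathcal{M}'(A)=\mathcal{M}(A)/G_\emptyset$ (quotient by the image of $G_\emptyset$); $\operatorname{Gr}\mathcal{M}'$ is a simplicial poset. The face module is $\mathbf{k}[\mathcal{M}]=\mathbf{k}[\operatorname{Gr}\mathcal{M}']^{m(\emptyset)}$, with Hilbert series $\sum_i\dim_{\mathbf{k}}(\mathbf{k}[\mathcal{M}]_i)t^i$. The arithmetic (Grothendieck–)Tutte polynomial is $T_{\mathcal{M}}(x,y)=\sum_{A\subseteq[n]}m(A)(x-1)^{r-\operatorname{cork}(A)}(y-1)^{\#A-\operatorname{cork}(A)}$, and $\mathcal{M}^*$ is the dual matroid over $\mathbb{Z}$ (in the sense of D'Adderio–Moci), which is again realizable and satisfies $T_{\mathcal{M}^*}(x,y)=T_{\mathcal{M}}(y,x)$. *)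

(* Defs.v *)
From HB Require Import structures.
From Stdlib Require Import Relation_Operators.
From mathcomp Require Import all_boot all_order all_algebra.
From mathcomp Require Import generic_quotient ring_quotient fraction finmap.
From mathcomp Require Import boolp classical_sets functions cardinality fsbigop.
From mathcomp Require Import reals complex monalg zify.

Set Implicit Arguments.
Unset Strict Implicit.
Unset Printing Implicit Defensive.

Import Order.TTheory GRing.Theory Num.Theory.
Local Open Scope classical_set_scope.
Local Open Scope ring_scope.
Local Open Scope quotient_scope.

Definition isog (V W : zmodType) : Prop :=
  exists f : {additive V -> W}, bijective f.

Definition is_subgroup (V : zmodType) (H : set V) : Prop :=
  H 0 /\ forall x y, H x -> H y -> H (x - y).

Definition subgroup_gen (V : zmodType) (S : set V) : set V :=
  smallest (@is_subgroup V) S.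

Definition fin_gen (V : zmodType) : Prop :=
  exists s : seq V, subgroup_gen [set x | x \in s] = setT.

Section GroupQuotient.
Variables (V : zmodType) (S : set V).

Definition subgroup_pred : {pred V} := fun v => `[< subgroup_gen S v >].

Lemma subgroup_pred_closed : zmod_closed subgroup_pred.
Proof.
split=> [|x y /asboolP Hx /asboolP Hy]; apply/asboolP=> H [sH SH].
  by case: sH.
by apply: sH.2; [apply: Hx|apply: Hy].
Qed.

HB.instance Definition _ :=
  GRing.isZmodClosed.Build V subgroup_pred subgroup_pred_closed.

(* The quotient of V by the subgroup generated by S. *)
Definition gquot : zmodType := {ideal_quot subgroup_pred}.

Definition gclass (v : V) : gquot := \pi_({ideal_quot subgroup_pred}) v.

Lemma gclass_is_additive : zmod_morphism gclass.
Proof. by move=> x y; rewrite /gclass raddfB. Qed.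

HB.instance Definition _ :=
  GRing.isZmodMorphism.Build V gquot gclass gclass_is_additive.

Definition grepr (q : gquot) : V := repr (q : {ideal_quot subgroup_pred}).

Lemma greprK : cancel grepr gclass.
Proof. by move=> q; rewrite /gclass /grepr reprK. Qed.

Lemma gclass_eq x y : gclass x = gclass y <-> subgroup_gen S (x - y).
Proof.
split=> [/eqP|/asboolP h].
  by rewrite /gclass -Quotient.idealrBE => /asboolP.
by apply/eqP; rewrite /gclass -Quotient.idealrBE.
Qed.

End GroupQuotient.

Section Torsion.
Variable V : zmodType.

Definition torsion_pred : {pred V} :=
  fun v => `[< exists2 k : nat, (0 < k)%N & v *+ k = 0 >].

Lemma torsion_pred_closed : zmod_closed torsion_pred.
Proof.
split=> [|x y /asboolP[k k0 hk] /asboolP[l l0 hl]]; apply/asboolP.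
  by exists 1%N.
exists (k * l)%N; first by rewrite muln_gt0 k0.
by rewrite mulrnBl mulrnA hk mul0rn mulnC mulrnA hl mul0rn subr0.
Qed.

HB.instance Definition _ :=
  GRing.isZmodClosed.Build V torsion_pred torsion_pred_closed.

Record torsion := Torsion { torsion_val : V; _ : torsion_val \in torsion_pred }.

HB.instance Definition _ := [isSub for torsion_val].
HB.instance Definition _ := [Choice of torsion by <:].
HB.instance Definition _ := [SubChoice_isSubZmodule of torsion by <:].

End Torsion.

Arguments torsion_pred : clear implicits.

Section TorsionMap.
Variables (V W : zmodType) (f : {additive V -> W}).

Lemma torsion_map_subproof (x : torsion V) : f (torsion_val x) \in torsion_pred W.
Proof.
case: x => v /= /asboolP[k k0 hk]; apply/asboolP; exists k => //.
by rewrite -raddfMn hk raddf0.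
Qed.

Definition torsion_map (x : torsion V) : torsion W :=
  Torsion (torsion_map_subproof x).

Lemma torsion_map_is_additive : zmod_morphism torsion_map.
Proof. by move=> x y; apply: val_inj; rewrite /= raddfB. Qed.

HB.instance Definition _ := GRing.isZmodMorphism.Build (torsion V) (torsion W)
  torsion_map torsion_map_is_additive.

End TorsionMap.

(* For a finitely generated V ~ Z^d x G with G finite: [zrank V] is d, and G is
   the torsion subgroup, of order [tcard V]. *)
Definition zrank (V : zmodType) : nat :=
  xget 0%N [set d | exists G : finZmodType, isog V ('rV[int]_d * G)%type].

Definition tcard (V : zmodType) : nat := #|` fset_set [set: torsion V] |.

Definition patching (n : nat) (M : {set 'I_n} -> zmodType) : Prop :=
  forall (A : {set 'I_n}) (b c : 'I_n), b \notin A -> c \notin A ->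
  exists x y : M A,
    [/\ isog (M (b |: A)%SET) (gquot [set x]),
        isog (M (c |: A)%SET) (gquot [set y]) &
        isog (M (b |: (c |: A))%SET) (gquot [set x; y])].

Record matroidZ (n : nat) := MatroidZ {
  mgroup :> {set 'I_n} -> zmodType;
  mgroup_fg : forall A, fin_gen (mgroup A);
  mgroup_patching : patching mgroup }.

Section MatroidZ.
Variables (n : nat) (M : matroidZ n).

(* A free direct summand of a finitely generated group has finite rank. *)
Definition essential : Prop :=
  forall (W : zmodType) (p : nat), isog (M [set: 'I_n]%SET) (W * 'rV[int]_p)%type ->
  p = 0%N.

Definition mcork (A : {set 'I_n}) : nat := (zrank (M finset.set0) - zrank (M A))%N.

Definition mrank : nat := mcork [set: 'I_n]%SET.

(* The values of the Tutte polynomial in a commutative ring; corank is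
   monotone and at most #|A|, so the truncated subtractions are exact. *)
Definition tutte (K : comNzRingType) (x y : K) : K :=
  \sum_(A : {set 'I_n})
    (tcard (M A))%:R * (x - 1) ^+ (mrank - mcork A) * (y - 1) ^+ (#|A| - mcork A).

End MatroidZ.

Section Realization.
Variables (n : nat) (V : zmodType) (z : 'I_n -> V).

Definition zquot (A : {set 'I_n}) : zmodType := gquot [set z i | i in [set` A]].

Definition zproj (A : {set 'I_n}) (b : 'I_n) (q : zquot A) : zquot (b |: A)%SET :=
  gclass _ (grepr q).

Lemma zproj_gclass (A : {set 'I_n}) (b : 'I_n) (v : V) :
  zproj b (gclass _ v : zquot A) = gclass _ v.
Proof.
apply/gclass_eq; have /gclass_eq : gclass _ (grepr (gclass _ v : zquot A)) = (gclass _ v : zquot A).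
  exact: greprK.
move=> h H [sH SH]; apply: h; split=> // x [i iA <-]; apply: SH; exists i => //=.
by rewrite in_setU1 [_ \in _]iA orbT.
Qed.

Lemma zproj_is_additive A b : zmod_morphism (@zproj A b).
Proof.
move=> x y; rewrite -[x]greprK -[y]greprK -(raddfB (gclass _)) !zproj_gclass.
exact: raddfB.
Qed.

HB.instance Definition _ A b := GRing.isZmodMorphism.Build (zquot A)
  (zquot (b |: A)%SET) (@zproj A b) (@zproj_is_additive A b).

End Realization.

Definition realization (n : nat) (M : matroidZ n) (z : 'I_n -> M finset.set0) : Prop :=
  forall A, isog (M A) (zquot z A).

(* Hom(G, C^* ), with C = R[i] *)
Record character (R : realType) (G : zmodType) := Character {
  char_fun :> G -> R[i];
  char_neq0 : forall x, char_fun x != 0;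
  charD : forall x y, char_fun (x + y) = char_fun x * char_fun y }.

Section CharPull.
Variables (R : realType) (G H : zmodType) (f : {additive G -> H}).

Lemma char_pull_subproof (h : character R H) x y :
  h (f (x + y)) = h (f x) * h (f y).
Proof. by rewrite raddfD charD. Qed.

Definition char_pull (h : character R H) : character R G :=
  Character (fun x => char_neq0 h (f x)) (char_pull_subproof h).

End CharPull.

Section PosetOfTorsions.
Variables (R : realType) (n : nat) (V : zmodType) (z : 'I_n -> V).

Record Gr := MkGr {
  gr_set : {set 'I_n};
  gr_indep : (zrank V - zrank (zquot z gr_set))%N = #|gr_set|;
  gr_char : character R (torsion (zquot z gr_set)) }.

(* [gr_covers x y] : y covers x *)
Inductive gr_covers : Gr -> Gr -> Prop :=
  GrCovers (A : {set 'I_n}) (b : 'I_n) iA iAb l h :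
    b \notin A -> char_pull (torsion_map (@zproj n V z A b)) h = l ->
    gr_covers (@MkGr A iA l) (@MkGr (b |: A)%SET iAb h).

Definition gr_le : Gr -> Gr -> Prop := clos_refl_trans Gr gr_covers.

End PosetOfTorsions.

Definition is_ideal (A : comNzRingType) (I : set A) : Prop :=
  is_subgroup I /\ forall a x, I x -> I (a * x).

Definition ideal_gen (A : comNzRingType) (S : set A) : set A :=
  smallest (@is_ideal A) S.

Section AlgQuotient.
Variables (k : fieldType) (A : comAlgType k) (S : set A).

Definition ideal_pred : {pred A} := fun a => `[< ideal_gen S a >].

Lemma ideal_pred_closed : zmod_closed ideal_pred.
Proof.
split=> [|x y /asboolP Hx /asboolP Hy]; apply/asboolP=> I [sI SI].
  by case: sI.1.
by apply: sI.1.2; [apply: Hx|apply: Hy].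
Qed.

HB.instance Definition _ :=
  GRing.isZmodClosed.Build A ideal_pred ideal_pred_closed.

Lemma ideal_predM a x : x \in ideal_pred -> a * x \in ideal_pred.
Proof.
by move=> /asboolP Hx; apply/asboolP=> I [sI SI]; apply: sI.2; apply: Hx.
Qed.

(* The quotient of A by the ideal generated by S; the library's ring structure
   on {ideal_quot _} is only available for proper ideals. *)
Definition aquot : Type := {ideal_quot ideal_pred}.

HB.instance Definition _ := GRing.Zmodule.on aquot.

Definition aclass (a : A) : aquot := \pi_({ideal_quot ideal_pred}) a.

Definition arepr (q : aquot) : A := repr (q : {ideal_quot ideal_pred}).

Lemma areprK : cancel arepr aclass.
Proof. by move=> q; rewrite /aclass /arepr reprK. Qed.

Lemma aclass_eq a b : aclass a = aclass b <-> ideal_gen S (a - b).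
Proof.
split=> [/eqP|/asboolP h].
  by rewrite /aclass -Quotient.idealrBE => /asboolP.
by apply/eqP; rewrite /aclass -Quotient.idealrBE.
Qed.

Lemma aclass_is_additive : zmod_morphism aclass.
Proof. by move=> x y; rewrite /aclass raddfB. Qed.

HB.instance Definition _ :=
  GRing.isZmodMorphism.Build A aquot aclass aclass_is_additive.

Definition aone : aquot := aclass 1.
Definition amul (p q : aquot) : aquot := aclass (arepr p * arepr q).
Definition ascale (c : k) (q : aquot) : aquot := aclass (c *: arepr q).

Lemma ideal_arepr a : a - arepr (aclass a) \in ideal_pred.
Proof. by apply/asboolP/aclass_eq; rewrite areprK. Qed.

Lemma aclassM a b : aclass (a * b) = amul (aclass a) (aclass b).
Proof.
apply/aclass_eq; set a' := arepr _; set b' := arepr _.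
suff: a * b - a' * b' \in ideal_pred by move/asboolP.
have -> : a * b - a' * b' = b * (a - a') + a' * (b - b').
  by rewrite !mulrBr ![b * _]mulrC addrA subrK.
by apply: rpredD; apply: ideal_predM; apply: ideal_arepr.
Qed.

Lemma aclassZ c a : aclass (c *: a) = ascale c (aclass a).
Proof.
apply/aclass_eq; rewrite -scalerBr -[X in c *: X]mul1r scalerAl.
suff: c *: 1 * (a - arepr (aclass a)) \in ideal_pred by move/asboolP.
exact/ideal_predM/ideal_arepr.
Qed.

Lemma amulA : associative amul.
Proof.
by move=> x y t; rewrite -[x]areprK -[y]areprK -[t]areprK -!aclassM mulrA.
Qed.

Lemma amulC : commutative amul.
Proof. by move=> x y; rewrite /amul mulrC. Qed.

Lemma amul1 : left_id aone amul.
Proof. by move=> x; rewrite -[x]areprK -aclassM mul1r. Qed.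

Lemma amulDl : left_distributive amul +%R.
Proof.
move=> x y t; rewrite -[x]areprK -[y]areprK -[t]areprK -raddfD -!aclassM.
by rewrite mulrDl raddfD.
Qed.

HB.instance Definition _ :=
  GRing.Zmodule_isComPzRing.Build aquot amulA amulC amul1 amulDl.

Lemma ascaleA b c x : ascale b (ascale c x) = ascale (b * c) x.
Proof. by rewrite -[x]areprK -!aclassZ scalerA. Qed.

Lemma ascale1 : left_id 1 ascale.
Proof. by move=> x; rewrite /ascale scale1r areprK. Qed.

Lemma ascaleDr : right_distributive ascale +%R.
Proof.
move=> c x y; rewrite -[x]areprK -[y]areprK -raddfD -!aclassZ scalerDr.
exact: raddfD.
Qed.

Lemma ascaleDl x : {morph ascale^~ x : b c / b + c}.
Proof. by move=> b c; rewrite /ascale scalerDl raddfD. Qed.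

HB.instance Definition _ := GRing.Zmodule_isLmodule.Build k aquot
  ascaleA ascale1 ascaleDr ascaleDl.

End AlgQuotient.

Section FaceRing.
Variables (k : fieldType) (P : choiceType) (le : P -> P -> Prop).

Definition is_glb (s t m : P) : Prop :=
  [/\ le m s, le m t & forall u, le u s -> le u t -> le u m].

Definition joins (s t : P) : set P :=
  [set g | [/\ le s g, le t g &
     forall u, le s u -> le t u -> le u g -> u = g]].

(* The rank of s when [0, s] is Boolean: the r such that [0, s] is isomorphic
   to the lattice of subsets of an r-element set. *)
Definition prank (s : P) : nat :=
  xget 0%N [set r | exists f : {set 'I_r} -> P,
    (forall A B, le (f A) (f B) <-> (A \subset B)) /\
    [set f A | A in setT] = [set t | le t s]].

Definition face_poly : comAlgType k := {malg k[{cmonom P}]}.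

Definition face_var (s : P) : face_poly := << ucm s >>.

(* When s and t have no common upper bound they need not have a greatest lower
   bound; the sum is then empty and the relation reads x_s x_t = 0. *)
Definition face_relations : set face_poly :=
  [set p | (exists o, (forall s, le o s) /\ p = face_var o - 1) \/
    (exists s t m, (joins s t !=set0 -> is_glb s t m) /\
       p = face_var s * face_var t
           - face_var m * \sum_(g \in joins s t) face_var g)].

Definition face_ring := aquot face_relations.

Definition face_mdeg (m : {cmonom P}) : nat :=
  (\sum_(s <- finsupp m) m s * prank s)%N.

Definition face_comp (i : nat) : set face_ring :=
  [set aclass face_relations p | p in
    [set p : face_poly | forall m, m \in msupp p -> face_mdeg m = i]].

End FaceRing.

Section Hilbert.
Variables (k : fieldType) (W : lmodType k).

Definition has_dim (U : set W) (d : nat) : Prop :=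
  exists b : 'I_d -> W,
    (forall w, U w <-> exists c : 'I_d -> k, w = \sum_(j < d) c j *: b j) /\
    (forall c : 'I_d -> k, \sum_(j < d) c j *: b j = 0 -> forall j, c j = 0).

(* The power series sum_i h_i t^i is the expansion at 0 of the rational
   function F, i.e. F = p / q with q(0) != 0 and q * sum_i h_i t^i = p. *)
Definition power_series_of (h : nat -> nat) (F : {fraction {poly rat}}) : Prop :=
  exists p q : {poly rat},
    [/\ q.[0] != 0, F = tofrac p / tofrac q &
        forall i, \sum_(j < i.+1) q`_j * (h (i - j)%N)%:R = p`_i].

Definition hilbert_series (gr : nat -> set W) (F : {fraction {poly rat}}) : Prop :=
  exists h : nat -> nat, (forall i, has_dim (gr i) (h i)) /\ power_series_of h F.

End Hilbert.

Section FaceModule.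
Variables (k : fieldType) (R : realType) (n : nat) (V : zmodType) (z : 'I_n -> V).

(* The realization of M' : M'(0) is V modulo its torsion subgroup. *)
Definition red_group : zmodType := gquot [set v | v \in torsion_pred V].

Definition red_vec (i : 'I_n) : red_group := gclass _ (z i).

Definition red_poset : choiceType := {classic Gr R red_vec}.

Definition red_le : red_poset -> red_poset -> Prop := @gr_le R n red_group red_vec.

Definition face_module := {ffun 'I_(tcard V) -> face_ring k red_le}.

HB.instance Definition _ := GRing.Lmodule.on face_module.

Definition face_module_comp (i : nat) : set face_module :=
  [set w | forall j, face_comp i (w j)].

End FaceModule.

Arguments face_module_comp k R {n V} z i _.

(* A presentation of (V; z_1, ..., z_n): V = Z^m / <rows of Q> with the rows of
   Q linearly independent, the i-th row of X being a lift of z_i. *)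
Record presentation (n : nat) (V : zmodType) (z : 'I_n -> V) := Presentation {
  pres_gens : nat;
  pres_rels : nat;
  pres_map : {additive 'rV[int]_pres_gens -> V};
  pres_lift : 'M[int]_(n, pres_gens);
  pres_rel : 'M[int]_(pres_rels, pres_gens);
  pres_surj : forall v, exists u, pres_map u = v;
  pres_liftP : forall i, pres_map (row i pres_lift) = z i;
  pres_ker : forall u,
    pres_map u = 0 <-> exists c : 'rV[int]_pres_rels, u = c *m pres_rel;
  pres_free : forall c : 'rV[int]_pres_rels, c *m pres_rel = 0 -> c = 0 }.

(* The Gale dual: with P the m x (n + k) matrix whose columns are the lifts of
   the z_i followed by the relations, the dual group is Z^(n + k) modulo the
   rows of P, and the dual vectors are the classes of e_1, ..., e_n. *)
Section GaleDual.
Variables (n : nat) (V : zmodType) (z : 'I_n -> V) (p : presentation z).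

Definition dual_mx : 'M[int]_(pres_gens p, n + pres_rels p) :=
  (col_mx (pres_lift p) (pres_rel p))^T.

Definition dual_group : zmodType := gquot [set row i dual_mx | i in setT].

Definition dual_vec (i : 'I_n) : dual_group :=
  gclass _ (delta_mx 0 (lshift (pres_rels p) i)).

End GaleDual.

Definition is_dual (n : nat) (M : matroidZ n) (N : matroidZ n) : Prop :=
  exists (z : 'I_n -> M finset.set0) (p : presentation z),
    realization z /\ forall A, isog (N A) (zquot (dual_vec p) A).

Lemma subgroup_genP (V : zmodType) (S : set V) : is_subgroup (subgroup_gen S).
Proof.
have [h0 hB] := subgroup_pred_closed S; split; first exact/asboolP.
by move=> x y /asboolP hx /asboolP hy; apply/asboolP/hB.
Qed.

Lemma sub_gen (V : zmodType) (S : set V) : S `<=` subgroup_gen S.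
Proof. by move=> x Sx H [_]; apply. Qed.

Lemma gen_min (V : zmodType) (S H : set V) :
  is_subgroup H -> S `<=` H -> subgroup_gen S `<=` H.
Proof. by move=> sH SH x; apply. Qed.

Lemma is_subgroupD (V : zmodType) (H : set V) x y :
  is_subgroup H -> H x -> H y -> H (x + y).
Proof.
move=> sH hx hy; rewrite -[y]opprK; apply: sH.2 => //.
by rewrite -sub0r; apply: sH.2 => //; case: sH.
Qed.

Lemma is_subgroup_preim (V W : zmodType) (f : {additive V -> W}) (H : set W) :
  is_subgroup H -> is_subgroup (f @^-1` H).
Proof.
case=> h0 hB; split; first by rewrite /preimage /= raddf0.
by move=> x y hx hy; rewrite /preimage /= raddfB; apply: hB.
Qed.

Lemma gclass0 (V : zmodType) (S : set V) v :
  gclass S v = 0 <-> subgroup_gen S v.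
Proof. by rewrite -(raddf0 (gclass S)) gclass_eq subr0. Qed.

Lemma isog_ker (V W : zmodType) (S : set V) (f : {additive V -> W}) :
  (forall w, exists v, f v = w) -> (forall v, f v = 0 <-> subgroup_gen S v) ->
  isog (gquot S) W.
Proof.
move=> fs fk; pose g (q : gquot S) : W := f (grepr q).
have gE v : g (gclass S v) = f v.
  apply/eqP; rewrite -subr_eq0 -raddfB; apply/eqP/fk/gclass_eq.
  exact: greprK.
have ga : zmod_morphism g.
  by move=> x y; rewrite -[x]greprK -[y]greprK -(raddfB (gclass S)) !gE raddfB.
pose gM := GRing.isZmodMorphism.Build _ _ g ga.
pose G : {additive gquot S -> W} := HB.pack g gM.
exists G; pose s w := gclass S (sval (cid (fs w))).
exists s => [q|w]; last by rewrite /= gE; case: (cid _).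
rewrite /s; case: (cid _) => v /= hv; rewrite -[RHS]greprK.
by apply/gclass_eq/fk; rewrite raddfB hv subrr.
Qed.

Lemma gen_gclass (V : zmodType) (S T : set V) v :
  subgroup_gen [set gclass S x | x in T] (gclass S v) <->
  subgroup_gen (S `|` T) v.
Proof.
split.
  set H := subgroup_gen (S `|` T) => h.
  have sH : is_subgroup H by apply: subgroup_genP.
  have kH : subgroup_gen S `<=` H by apply: gen_min => // x Sx; apply: sub_gen; left.
  suff [w Hw /gclass_eq wv] : [set gclass S x | x in H] (gclass S v).
    rewrite -[v](subKr w); apply: sH.2 => //; exact: kH.
  apply: h; split; last by move=> _ [x Tx <-]; exists x => //; apply: sub_gen; right.
  split; first by exists 0; [case: sH|rewrite raddf0].
  by move=> _ _ [x hx <-] [y hy <-]; exists (x - y); [apply: sH.2|rewrite raddfB].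
move: v; apply: gen_min => [|x [Sx|Tx]].
- exact/is_subgroup_preim/subgroup_genP.
- have /gclass0 -> : subgroup_gen S x by apply: sub_gen.
  by case: (subgroup_genP [set gclass S x | x in T]).
- by apply: sub_gen; exists x.
Qed.

Lemma isog_gquot2 (V : zmodType) (S T U : set V) (X : set (gquot S)) :
  U = S `|` T -> X = [set gclass S x | x in T] -> isog (gquot U) (gquot X).
Proof.
move=> -> ->; pose f : V -> gquot [set gclass S x | x in T] :=
  fun v => gclass _ (gclass S v).
have fa : zmod_morphism f by move=> x y; rewrite /f !raddfB.
pose fM := GRing.isZmodMorphism.Build _ _ f fa.
pose F : {additive V -> _} := HB.pack f fM.
apply: (@isog_ker _ _ _ F) => [w|v]; last by rewrite /= /f gclass0 gen_gclass.
by exists (grepr (grepr w)); rewrite /= /f !greprK.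
Qed.

Lemma fin_gen_surj (V W : zmodType) (f : {additive V -> W}) :
  (forall w, exists v, f v = w) -> fin_gen V -> fin_gen W.
Proof.
move=> fs [s hs]; exists (map f s); apply/seteqP; split=> // w _.
have [v <-] := fs w; have : subgroup_gen [set x | x \in s] v by rewrite hs.
move: v; apply: gen_min; first exact/is_subgroup_preim/subgroup_genP.
by move=> x xs; apply: sub_gen; apply: map_f.
Qed.

Lemma fin_gen_gquot (V : zmodType) (S : set V) : fin_gen V -> fin_gen (gquot S).
Proof.
by apply: (fin_gen_surj (f := gclass S)) => w; exists (grepr w); apply: greprK.
Qed.

Lemma is_subgroup_sumz (V : zmodType) (H : set V) (I : Type) (r : seq I)
    (c : I -> int) (x : I -> V) :
  is_subgroup H -> (forall i, H (x i)) -> H (\sum_(i <- r) x i *~ c i).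
Proof.
move=> sH Hx; elim/big_rec: _ => [|i y _ Hy]; first by case: sH.
apply: (is_subgroupD sH) => //.
have Hn m : H (x i *+ m).
  elim: m => [|m IH]; first by case: sH.
  by rewrite mulrS; apply: (is_subgroupD sH).
case: (c i) => m; first exact: Hn.
by rewrite NegzE mulrNz -sub0r; apply: sH.2; [case: sH|apply: Hn].
Qed.

Lemma fin_gen_rV m : fin_gen 'rV[int]_m.
Proof.
exists [seq delta_mx 0 j | j <- enum 'I_m]; apply/seteqP; split=> // u _.
have -> : u = \sum_j delta_mx 0 j *~ u 0 j.
  rewrite {1}[u]row_sum_delta; apply: eq_bigr => j _.
  by rewrite -scaler_int intz.
apply: (is_subgroup_sumz _ _ (subgroup_genP _)) => j; apply: sub_gen.
by apply: map_f; rewrite mem_enum.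
Qed.

Section RealizedMatroid.
Variables (n : nat) (V : zmodType) (z : 'I_n -> V) (fgV : fin_gen V).

Lemma zquot_patching : patching (zquot z).
Proof.
move=> A b c bA cA; exists (gclass _ (z b)), (gclass _ (z c)).
have img (B : {set 'I_n}) i : [set z j | j in [set` (i |: B)%SET]] =
    [set z j | j in [set` B]] `|` [set z i].
  apply/seteqP; split=> [_ [j /= + <-]|_ [[j jB <-]|->]].
  - by rewrite in_setU1 => /orP[/eqP->|jB]; [right|left; exists j].
  - by exists j => //=; rewrite in_setU1 [_ \in _]jB orbT.
  - by exists i => //=; rewrite setU11.
split.
- apply: (@isog_gquot2 _ _ [set z b]); first exact: img.
  by rewrite image_set1.
- apply: (@isog_gquot2 _ _ [set z c]); first exact: img.
  by rewrite image_set1.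
- apply: (@isog_gquot2 _ _ [set z b; z c]).
    by rewrite !img -setUA [X in _ `|` X]setUC.
  by rewrite image_setU !image_set1.
Qed.

Definition realized_matroid : matroidZ n :=
  MatroidZ (fun A => fin_gen_gquot _ fgV) zquot_patching.

End RealizedMatroid.

Lemma subgroup_rV_basis m (H : set 'rV[int]_m) : is_subgroup H ->
  exists k (Q : 'M[int]_(k, m)),
    (forall u, H u <-> exists c : 'rV[int]_k, u = c *m Q) /\
    (forall c : 'rV[int]_k, c *m Q = 0 -> c = 0).
Proof.
elim: m H => [|m IH]; last rewrite -[m.+1]/(1 + m)%N; move=> H sH.
  exists 0%N, 0; split=> [u|c _]; last by rewrite thinmx0.
  split=> _; last by rewrite thinmx0; case: sH.
  by exists 0; rewrite !thinmx0.
pose K : set 'rV[int]_m := [set w | H (row_mx (0 : 'rV_1) w)].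
have sK : is_subgroup K.
  split; first by rewrite /K /= row_mx0; case: sH.
  move=> x y hx hy; rewrite /K /=.
  suff -> : row_mx (0 : 'rV[int]_1) (x - y) = row_mx 0 x - row_mx 0 y by apply: sH.2.
  by rewrite opp_row_mx add_row_mx oppr0 addr0.
have [k [Q [QK Qfree]]] := IH K sK.
have kerH (u : 'rV[int]_(1 + m)) : H u -> u 0 0 = 0 -> exists c : 'rV[int]_k, u = c *m row_mx 0 Q.
  move=> Hu u0; have uE : u = row_mx 0 (rsubmx u).
    rewrite -{1}[u]hsubmxK; congr row_mx; apply/rowP => i.
    by rewrite !mxE ord1 -[RHS]u0; congr (u 0 _); apply/val_inj.
  have /QK[c hc] : K (rsubmx u) by rewrite /K /= -uE.
  by exists c; rewrite mul_mx_row mulmx0 -hc.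
have [[u1 Hu1 u10]|none] := pselect (exists2 u : 'rV[int]_(1 + m), H u & u 0 0 != 0); last first.
  exists k, (row_mx (0 : 'M_(k,1)) Q); split=> [u|c].
    split=> [Hu|[c ->]].
      apply: kerH => //; apply/eqP; apply: contrapT => /negP u0.
      by apply: none; exists u.
    by rewrite mul_mx_row mulmx0; apply/QK; exists c.
  rewrite mul_mx_row mulmx0 -(row_mx0 _ 1 1 m) => /eq_row_mx[_]; exact: Qfree.
pose D d := `[< exists u : 'rV[int]_(1 + m), [/\ H u, u 0 0 != 0 & absz (u 0 0) = d] >].
have exD : exists d, D d by exists (absz (u1 0 0)); apply/asboolP; exists u1.
case: (ex_minnP exD) => d /asboolP[w [Hw w0 wd]] dmin.
have HZ (u : 'rV[int]_(1 + m)) (a : int) : H u -> H (a *: u).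
  move=> Hu; have := is_subgroup_sumz [:: tt] (fun=> a) (x := fun=> u) sH (fun=> Hu).
  by rewrite big_seq1 -scaler_int intz.
have step (u : 'rV[int]_(1 + m)) : H u -> exists (a : int) (c : 'rV[int]_k),
    u = a *: w + c *m row_mx 0 Q.
  move=> Hu; pose a := divz (u 0 0) (w 0 0); pose v := u - a *: w.
  have Hv : H v by apply: sH.2 => //; apply: HZ.
  have v00 : v 0 0 = modz (u 0 0) (w 0 0) by rewrite !mxE /modz.
  have v0 : v 0 0 = 0.
    apply/eqP; apply: contrapT => /negP vn0.
    have /dmin : D (absz (v 0 0)) by apply/asboolP; exists v.
    rewrite -wd v00; have := ltz_mod (u 0 0) w0; have := modz_ge0 (u 0 0) w0.
    by lia.
  have [c hc] := kerH v Hv v0; exists a, c.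
  by rewrite -hc addrC subrK.
exists (1 + k)%N, (col_mx w (row_mx (0 : 'M_(k,1)) Q)); split=> [u|c].
  split=> [/step[a [c uE]]|[c ->]].
    exists (row_mx a%:M c); by rewrite mul_row_col mul_scalar_mx.
  rewrite -[c]hsubmxK mul_row_col [lsubmx c]mx11_scalar mul_scalar_mx.
  apply: (is_subgroupD sH) => //; first exact: HZ.
  by rewrite mul_mx_row mulmx0; apply/QK; exists (rsubmx c).
rewrite -{1}[c]hsubmxK mul_row_col [lsubmx c]mx11_scalar mul_scalar_mx.
set a := lsubmx c 0 0 => h.
have a0 : a = 0.
  move/rowP/(_ 0): (h); rewrite mul_mx_row mulmx0 !mxE.
  case: splitP => // j _; rewrite mxE addr0 => /eqP.
  by rewrite mulf_eq0 (negbTE w0) orbF => /eqP.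
move: h; rewrite a0 scale0r add0r mul_mx_row mulmx0 -(row_mx0 _ 1 1 m).
move=> /eq_row_mx[_ /Qfree c0].
by rewrite -[c]hsubmxK c0 [lsubmx c]mx11_scalar -/a a0 raddf0 row_mx0.
Qed.

Lemma presentation_exists (n : nat) (V : zmodType) (z : 'I_n -> V) :
  fin_gen V -> inhabited (presentation z).
Proof.
move=> [s hs]; pose m := size s.
pose f (u : 'rV[int]_m) : V := \sum_(j < m) s`_j *~ u 0 j.
have fa : zmod_morphism f.
  move=> x y; rewrite /f -sumrB; apply: eq_bigr => j _.
  by rewrite !mxE mulrzBr.
pose fM := GRing.isZmodMorphism.Build _ _ f fa.
pose F : {additive 'rV[int]_m -> V} := HB.pack f fM.
have Fs v : exists u, F u = v.
  have : subgroup_gen [set x | x \in s] v by rewrite hs.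
  move: v; apply: gen_min.
    split; first by exists 0; rewrite raddf0.
    by move=> _ _ [x <-] [y <-]; exists (x - y); rewrite raddfB.
  move=> x xs; have xm : (index x s < m)%N by rewrite index_mem.
  exists (delta_mx 0 (Ordinal xm)); rewrite /= /f (bigD1 (Ordinal xm)) //=.
  rewrite mxE !eqxx /= nth_index // big1 ?addr0 // => j jn.
  by rewrite mxE (negbTE jn) andbF.
have sk : is_subgroup [set u | F u = 0].
  split=> [|x y hx hy]; first exact: (raddf0 F).
  by apply: etrans (raddfB F x y) _; rewrite [F x]hx [F y]hy subrr.
have [k [Q [Qk Qf]]] := subgroup_rV_basis sk.
pose X := \matrix_(i < n) sval (cid (Fs (z i))).
constructor; apply: (@Presentation _ _ z m k F X Q) => // i.
by rewrite rowK; case: (cid _).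
Qed.

Lemma is_dual_exists (n : nat) (M : matroidZ n) (z : 'I_n -> M finset.set0) :
  realization z -> exists N, is_dual M N.
Proof.
move=> hz; have [p] := presentation_exists z (mgroup_fg M _).
exists (realized_matroid (dual_vec p) (fin_gen_gquot _ (fin_gen_rV _))).
exists z, p; split=> // A; exists idfun; exact: (Bijective (g := id)).
Qed.

(* Main.v *)
(**
Both sides equal the sum over the independent sets I of m(I) (t / (1 - t))^#I.

For the face ring, label every element (A, l) of Gr M' by its set A; the elements
below it are its restrictions to the subsets of A. The products
x_s * prod_(v in A) x_(s|v)^(a_v - 1), with s over A and all a_v > 0 on A, span:
multiplication by x_t sends such a product to a sum of such products. They are
independent because for every s the ring map sending x_u to prod_(v in u) X_v if
u <= s, and to 0 otherwise, separates those below s. So every element over A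
contributes (t / (1 - t))^#A, and there are #Hom(G_A, C^* ) = m'(A) = m(A) / m(0)
of them when A is independent.

For the dual, M(A) is the cokernel of an integer matrix B and M*(complement of A)
is, up to a free summand, the cokernel of its transpose; by the Smith normal form
the two have the same torsion, and counting ranks shows that the sets of full
dual corank are the complements of the independent sets.
*)

From HB Require Import structures.
From Stdlib Require Import Relation_Operators.
From mathcomp Require Import all_boot all_order all_algebra.
From mathcomp Require Import cyclic separable cyclotomic fraction finmap.
From mathcomp Require Import boolp classical_sets functions cardinality fsbigop.
From mathcomp Require Import reals complex monalg zify ring.
Require Import Defs.

Set Implicit Arguments.
Unset Strict Implicit.
Unset Printing Implicit Defensive.

Import Order.TTheory GRing.Theory Num.Theory.
Local Open Scope classical_set_scope.
Local Open Scope ring_scope.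

(** At y = 1/t one has y - 1 = (1 - t) / t. The dual term at the complement of an independent I is
    therefore m(I) ((1 - t) / t)^(r - #I), and the factor t^r / (1 - t)^r turns it into m(I) (t / (1
    - t))^#I.

    Gr M has one minimal element for every character of the torsion of M(0). Dividing by this
    torsion leaves a single bottom element, and the m(0) copies in the face module restore the lost
    factor: the torsion of M(0) meets the span of an independent set only in 0, whence m(A) = m(0)
    m'(A).

    The order of Gr M' is generated by coverings, and its elements carry characters of different
    groups. Both difficulties disappear once a character of M'(A) is read as a partial function on
    the common group M'(0): the order becomes restriction of functions, and the face ring
    computation only sees label sets and restrictions.

    The Hilbert series is an identity of coefficients, so X / (1 - X) is replaced throughout by
    truncated polynomials. *)

Local Notation ratmx B := (map_mx (intr : int -> rat) B).

(** * Simplicial posets labelled by subsets *)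

(** Coordinates for a simplicial poset whose vertices are coloured injectively on every face: the
    interval below [t] is identified with the subsets of [supp t] through [rs t], so that meets,
    joins and ranks become set operations. [rs t A] carries information only for [A] inside
    [supp t]. *)
Record simplicial_labelling (n : nat) (P : choiceType) (le : P -> P -> Prop)
    (supp : P -> {set 'I_n}) (rs : P -> {set 'I_n} -> P) := SimplicialLabelling {
  slab_fin : finite_set [set: P];
  slab_le : forall s t, le s t <-> supp s \subset supp t /\ rs t (supp s) = s;
  slab_supp : forall t (A : {set _}), A \subset supp t -> supp (rs t A) = A;
  slab_id : forall t, rs t (supp t) = t;
  slab_comp : forall t (A B : {set _}), A \subset B -> B \subset supp t ->
    rs (rs t B) A = rs t A;
  slab_bot : exists o, supp o = finset.set0;
  slab_bot_uniq : forall s t, supp s = finset.set0 -> supp t = finset.set0 -> s = t }.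

Section LabelledPoset.
Variables (n : nat) (P : choiceType) (le : P -> P -> Prop).
Variables (supp : P -> {set 'I_n}) (rs : P -> {set 'I_n} -> P).
Hypothesis lab : simplicial_labelling le supp rs.

Let leE := slab_le lab.
Let supp_rs := slab_supp lab.
Let rs_id := slab_id lab.
Let rs_rs := slab_comp lab.

Lemma slab_le_supp s t : le s t -> supp s \subset supp t.
Proof. by case/leE. Qed.

Lemma slab_rs_le s (A : {set _}) : A \subset supp s -> le (rs s A) s.
Proof. by move=> As; apply/leE; rewrite supp_rs. Qed.

Lemma slab_rs_sub s (A B : {set _}) : A \subset B -> B \subset supp s -> le (rs s A) (rs s B).
Proof.
move=> AB Bs; have As := fintype.subset_trans AB Bs.
by apply/leE; rewrite !supp_rs // rs_rs.
Qed.

Lemma slab_refl s : le s s.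
Proof. by apply/leE. Qed.

Lemma slab_rs_leE s t (A : {set _}) : le s t -> A \subset supp s -> rs s A = rs t A.
Proof. by move=> /leE[st sE] As; rewrite -{1}sE rs_rs. Qed.

Lemma slab_trans s t u : le s t -> le t u -> le s u.
Proof.
move=> st tu; apply/leE; split.
  exact: fintype.subset_trans (slab_le_supp st) (slab_le_supp tu).
by rewrite -(slab_rs_leE tu) ?slab_le_supp //; case/leE: st.
Qed.

Lemma slab_le_eq s t u : le s u -> le t u -> supp s = supp t -> s = t.
Proof. by move=> /leE[_ sE] /leE[_ tE] st; rewrite -sE -tE st. Qed.

(** The interval below [u] is Boolean, so a minimal common upper bound inside it is cut out of [u]
    by the union of the labels. *)
Lemma slab_join_rs s t u : le s u -> le t u ->
  joins le s t (rs u (supp s :|: supp t)).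
Proof.
move=> su tu; have stu : supp s :|: supp t \subset supp u.
  by rewrite finset.subUset !slab_le_supp.
have [_ sE] := (leE _ _).1 su; have [_ tE] := (leE _ _).1 tu.
split.
- by rewrite -{1}sE; apply: slab_rs_sub => //; apply: finset.subsetUl.
- by rewrite -{1}tE; apply: slab_rs_sub => //; apply: finset.subsetUr.
move=> w sw tw wu; have wE := slab_le_supp wu.
apply: (slab_le_eq wu (slab_refl _)); apply/eqP; rewrite finset.eqEsubset wE /=.
by rewrite supp_rs // finset.subUset !slab_le_supp.
Qed.

Lemma slab_joinsP s t g :
  joins le s t g <-> [/\ le s g, le t g & supp g = supp s :|: supp t].
Proof.
split=> [[sg tg gm]|[sg tg gE]].
  split=> //; have [sj tj _] := slab_join_rs sg tg.
  have ug : supp s :|: supp t \subset supp g by rewrite finset.subUset !slab_le_supp.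
  by rewrite -{1}(gm _ sj tj (slab_rs_le ug)) supp_rs.
split=> // u su tu ug; apply: (slab_le_eq ug (slab_refl _)).
apply/eqP; rewrite finset.eqEsubset slab_le_supp //= gE finset.subUset !slab_le_supp //.
Qed.

Lemma slab_glb s t u : le s u -> le t u -> is_glb le s t (rs s (supp s :&: supp t)).
Proof.
move=> su tu; have sS := finset.subsetIl (supp s) (supp t).
split; first exact: slab_rs_le.
  rewrite (slab_rs_leE su) // -(slab_rs_leE tu) ?finset.subsetIr //.
  by apply: slab_rs_le; apply: finset.subsetIr.
move=> w ws wt; apply/leE; rewrite supp_rs // finset.subsetI !slab_le_supp //; split=> //.
by rewrite rs_rs ?finset.subsetI ?slab_le_supp //; case/leE: ws.
Qed.

Lemma slab_bot_le o s : supp o = finset.set0 -> le o s.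
Proof.
move=> o0; apply/leE; rewrite o0 finset.sub0set; split=> //.
by apply: (slab_bot_uniq lab); rewrite ?supp_rs ?finset.sub0set.
Qed.

Lemma slab_prank s : prank le s = #|supp s|.
Proof.
pose r := #|supp s|; pose Q r := exists f : {set 'I_r} -> P,
    (forall A B, le (f A) (f B) <-> (A \subset B)) /\
    [set f A | A in setT] = [set t | le t s].
have Qr : Q r.
  pose im (A : {set 'I_r}) := [set enum_val x | x in A]%SET.
  have ims A : im A \subset supp s.
    by apply/fintype.subsetP => _ /imsetP[x _ ->]; apply: enum_valP.
  have imS A B : (im A \subset im B) = (A \subset B).
    apply/idP/idP => [AB|]; last exact: imsetS.
    apply/fintype.subsetP => x xA; have := fintype.subsetP AB (enum_val x) (imset_f _ xA).
    by case/imsetP => y yB /enum_val_inj ->.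
  exists (fun A => rs s (im A)); split=> [A B|].
    split=> [/slab_le_supp|]; first by rewrite !supp_rs // imS.
    by rewrite -imS => AB; apply: slab_rs_sub.
  apply/seteqP; split=> [_ [A _ <-]|t /= ts]; first exact: slab_rs_le.
  have [tS tE] := (leE _ _).1 ts; exists [set x | enum_val x \in supp t]%SET => //.
  rewrite -[RHS]tE; congr rs; apply/setP => i; apply/imsetP/idP => [[x]|it].
    by rewrite inE => xt ->.
  have iS := fintype.subsetP tS i it; exists (enum_rank_in iS i).
    by rewrite inE enum_rankK_in.
  by rewrite enum_rankK_in.
(* [prank] is a choice among the admissible [q]; it is pinned down because two Boolean descriptions
   of the interval below [s] have 2 ^ q and 2 ^ r elements. *)
have Qu q : Q q -> q = r.
  move=> [f [fle fim]]; have [g [gle gim]] := Qr.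
  have anti q' (f' : {set 'I_q'} -> P) :
     (forall A B, le (f' A) (f' B) <-> (A \subset B)) -> injective f'.
    move=> h A B AB; apply/eqP; rewrite finset.eqEsubset; apply/andP.
    by split; apply/h; rewrite AB; apply: slab_refl.
  have half q1 q2 (f1 : {set 'I_q1} -> P) (f2 : {set 'I_q2} -> P) :
      injective f1 ->
      [set f1 A | A in setT] = [set f2 A | A in setT] -> (q1 <= q2)%N.
    move=> i1 im12; have ex A : exists B, f2 B = f1 A.
      have : [set f1 A | A in setT] (f1 A) by exists A.
      by rewrite im12 => -[B _ <-]; exists B.
    pose h A := sval (cid (ex A)).
    have hi : injective h.
      by move=> A B; rewrite /h; case: cid => x /= xA; case: cid => y /= yB xy;
         apply: i1; rewrite -xA -yB xy.
    have := leq_card h hi; rewrite -!cardsT -!finset.powersetT !card_powerset !cardsT !card_ord.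
    by rewrite leq_exp2l.
  apply/eqP; rewrite eqn_leq; apply/andP; split.
    by apply: (half _ _ f g); [exact: anti|rewrite fim gim].
  by apply: (half _ _ g f); [exact: anti|rewrite fim gim].
rewrite /prank; apply: Qu; exact: (xgetI 0%N Qr).
Qed.

End LabelledPoset.

(** * The face ring *)

Lemma aclass_gen (k : fieldType) (A : comAlgType k) (S : set A) a : S a -> aclass S a = 0.
Proof.
by move=> Sa; rewrite -(raddf0 (aclass S)); apply/aclass_eq; rewrite subr0 => I [_]; apply.
Qed.

Lemma aclass_mul (k : fieldType) (A : comAlgType k) (S : set A) a b :
  aclass S a * aclass S b = aclass S (a * b).
Proof. exact: esym (aclassM S a b). Qed.

Lemma finset_ind (T : finType) (Q : {set T} -> Prop) : Q finset.set0 ->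
  (forall v (B : {set T}), v \notin B -> Q B -> Q (v |: B)) -> forall B, Q B.
Proof.
move=> Q0 QU B; have [m] := ubnP #|B|; elim: m B => // m IH B.
have [->//|[v vB]] := set_0Vmem B.
rewrite (cardsD1 v) vB => Bm; rewrite -(finset.setD1K vB).
by apply: QU; [rewrite finset.setD11|apply: IH].
Qed.

(* The face ring enters the computations only through its defining relations. *)
Section FaceRelations.
Variables (n : nat) (P : choiceType) (le : P -> P -> Prop).
Variables (supp : P -> {set 'I_n}) (rs : P -> {set 'I_n} -> P).
Hypothesis lab : simplicial_labelling le supp rs.
Variables (A : comPzRingType) (x : P -> A).

Let supp_rs := slab_supp lab.
Let E : seq P := fset_set [set: P].

Lemma mem_slab s : s \in E.
Proof. by rewrite in_fset_set ?inE //; apply: slab_fin lab. Qed.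

Lemma slab_fsbig (B : zmodType) (S : set P) (F : P -> B) :
  \sum_(g \in S) F g = \sum_(g <- E | `[< S g >]) F g.
Proof.
rewrite [RHS]bigfs; last 2 first.
- exact: fset_uniq.
- by move=> i _; rewrite mem_slab.
by apply: eq_fsbigl; apply/seteqP; split=> i /= /asboolP.
Qed.

Hypothesis x_bot : forall o, supp o = finset.set0 -> x o = 1.
Hypothesis x_mul_glb : forall s t m, (joins le s t !=set0 -> is_glb le s t m) ->
  x s * x t = x m * \sum_(g <- E | `[< joins le s t g >]) x g.

Lemma x_mul s t :
  x s * x t = x (rs s (supp s :&: supp t)) * \sum_(g <- E | `[< joins le s t g >]) x g.
Proof.
by apply: x_mul_glb => -[g [sg tg _]]; apply: slab_glb lab _ _ _ sg tg.
Qed.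

Lemma x_mul0 s t : (forall u, le s u -> le t u -> False) -> x s * x t = 0.
Proof.
move=> st; rewrite x_mul big1 ?mulr0 // => g /asboolP[sg tg _].
by case: (st g).
Qed.

(* In x_(g|v) x_(g|B) = sum_d x_d only the summand d = g|(v + B) has an upper
   bound in common with g, so multiplication by x_g kills all the others. *)
Lemma x_mul_rs g (B : {set 'I_n}) : B \subset supp g ->
  x g * x (rs g B) = x g * \prod_(v in B) x (rs g [set v]%SET).
Proof.
elim/finset_ind: B => [|v B vB IH].
  by rewrite big_set0 [x (rs g _)]x_bot // supp_rs // finset.sub0set.
rewrite finset.subUset finset.sub1set => /andP[vg Bg].
have vBg : v |: B \subset supp g by rewrite finset.subUset finset.sub1set vg.
have v1g : [set v]%SET \subset supp g by rewrite finset.sub1set.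
rewrite big_setU1 //= mulrCA -IH // mulrCA [X in _ = _ * X]x_mul !supp_rs //.
have -> : ([set v] :&: B)%SET = finset.set0.
  by apply/setP => i; rewrite !inE; case: eqP => // ->; rewrite (negbTE vB).
rewrite [x (rs _ finset.set0)]x_bot ?mul1r; last by rewrite supp_rs // supp_rs // finset.sub0set.
have vBj : joins le (rs g [set v]%SET) (rs g B) (rs g (v |: B)).
  apply/(slab_joinsP lab); rewrite !supp_rs //; split=> //.
    by apply: (slab_rs_sub lab); rewrite ?finset.subsetUl.
  by apply: (slab_rs_sub lab); rewrite ?finset.subsetUr.
rewrite mulr_sumr big_mkcond (bigD1_seq (rs g (v |: B))) ?fset_uniq ?mem_slab //=.
rewrite asboolT // big1 ?addr0 // => d dvB; case: asboolP => // dj.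
apply: x_mul0 => u gu du; case/eqP: dvB.
have [_ _] := (slab_joinsP lab _ _ _).1 dj; rewrite !supp_rs // => dE.
apply: (slab_le_eq lab du); last by rewrite supp_rs.
exact: (slab_trans lab (slab_rs_le lab vBg)).
Qed.

(** The exponents are shifted by one because [x s] itself counts once for every vertex of [s]; in
    polynomial coordinates this is the monomial with exponent vector [a]. *)
Definition face_monomial (s : P) (a : 'I_n -> nat)  : A :=
  x s * \prod_(v in supp s) x (rs s [set v]%SET) ^+ (a v).-1.

(** The product of [x t] and [x s] is the variable of the meet times the sum over the joins [g].
    Each [x g] absorbs the meet as a product of vertices ([x_mul_rs]), which raises the exponents on
    the common vertices; the vertices of [t] outside [s] enter with exponent one through [x g]
    itself. *)
Lemma face_monomial_mul t s a : (forall v, (0 < a v)%N = (v \in supp s)) ->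
  x t * face_monomial s a =
  \sum_(g <- E | `[< joins le s t g >]) face_monomial g (fun v => a v + (v \in supp t))%N.
Proof.
move=> as_; rewrite /face_monomial mulrA [x t * _]mulrC x_mul -mulrA mulr_suml mulr_sumr.
apply: eq_bigr => g /asboolP/(slab_joinsP lab)[sg tg gE].
have ss := slab_le_supp lab sg; have st := slab_le_supp lab tg.
have sI := finset.subsetIl (supp s) (supp t).
rewrite (slab_rs_leE lab sg) // mulrA [_ * x g]mulrC x_mul_rs; last first.
  exact: fintype.subset_trans sI ss.
rewrite -mulrA; congr (_ * _).
rewrite !(big_mkcond (fun v => v \in _)) -big_split /=; apply: eq_bigr => v _.
rewrite gE !inE; have := as_ v; case: (boolP (v \in supp s)) => /= vs av.
  rewrite (slab_rs_leE lab sg) ?finset.sub1set //.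
  case: (v \in supp t) => /=; last by rewrite mul1r addn0.
  by rewrite -exprS addn1 /= prednK.
move: av; case: (a v) => // _; rewrite mulr1 add0n.
by case: (v \in supp t) => //=; rewrite expr0.
Qed.

End FaceRelations.

Section FaceMonomialSpan.
Variables (n : nat) (P : choiceType) (le : P -> P -> Prop).
Variables (supp : P -> {set 'I_n}) (rs : P -> {set 'I_n} -> P).
Hypothesis lab : simplicial_labelling le supp rs.
Variables (A : comPzRingType) (x : P -> A).
Let E : seq P := fset_set [set: P].
Hypothesis x_bot : forall o, supp o = finset.set0 -> x o = 1.
Hypothesis x_mul_glb : forall s t m, (joins le s t !=set0 -> is_glb le s t m) ->
  x s * x t = x m * \sum_(g <- E | `[< joins le s t g >]) x g.

Definition face_exponent (s : P) (a : 'I_n -> nat) : Prop :=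
  forall v, (0 < a v)%N = (v \in supp s).

(** Multiplicities are kept as repetitions in [L], so no coefficients are needed. The exponent sums
    are recorded in order to span each degree separately. *)
Lemma face_monomial_span (l : seq P) :
  exists L : seq (P * {ffun 'I_n -> nat}),
    (forall q, q \in L -> face_exponent q.1 q.2 /\
       (\sum_v q.2 v = \sum_(t <- l) #|supp t|)%N) /\
    \prod_(t <- l) x t = \sum_(q <- L) face_monomial supp rs x q.1 q.2.
Proof.
elim: l => [|t l [L [Lv LE]]].
  have [o o0] := slab_bot lab.
  exists [:: (o, [ffun=> 0%N])]; split=> [q|].
    rewrite inE => /eqP -> /=; split=> [v|]; first by rewrite ffunE o0 inE.
    by rewrite big_nil big1 // => v _; rewrite ffunE.
  by rewrite big_nil big_seq1 /face_monomial /= o0 big_set0 mulr1 x_bot.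
exists [seq (g, [ffun v => (q.2 v + (v \in supp t))%N]) |
          q : P * {ffun 'I_n -> nat} <- L, g : P <- [seq g <- E | `[< joins le q.1 t g >]]]; split=> [q|].
  case/allpairsPdep => q' [g [/Lv[qe qs]]]; rewrite mem_filter => /andP[/asboolP jg _] -> /=.
  have [_ _ gE] := (slab_joinsP lab _ _ _).1 jg; split=> [v|].
    by rewrite ffunE gE inE -qe addn_gt0 lt0b.
  rewrite big_cons -qs -sum1_card [X in (X + _)%N]big_mkcond -big_split /=; apply: eq_bigr => v _.
  by rewrite ffunE addnC; case: (v \in supp t).
rewrite big_cons LE mulr_sumr big_allpairs_dep /= !big_seq; apply: eq_bigr => q qL.
rewrite (face_monomial_mul lab x_bot x_mul_glb); last by have [] := Lv q qL.
rewrite big_filter; apply: eq_bigr => g _; rewrite /face_monomial.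
by congr (_ * _); apply: eq_bigr => v _; rewrite ffunE.
Qed.

End FaceMonomialSpan.

(** * Evaluation of the face ring in polynomial rings *)

Section MonomialAlgebra.
Variable k : fieldType.

Lemma malgU_mul (K : monomType) (m1 m2 : K) :
  (<< m1 >> * << m2 >> : {malg k[K]}) = << mmul m1 m2 >>.
Proof. by rewrite malgM_def fgmulUU mulr1. Qed.

Lemma prod_ucm (K : choiceType) (r : seq K) (m : {cmonom K}) :
  uniq r -> (forall v, v \notin r -> m v = 0%N) ->
  \prod_(v <- r) << ucm v >> ^+ m v = << m >> :> {malg k[{cmonom K}]}.
Proof.
move=> ur mr.
have powE (u : {cmonom K}) p : << u >> ^+ p = << iter p (mmul u) mone >> :> {malg k[{cmonom K}]}.
  elim: p => [|p IH]; first by rewrite expr0; congr << _ >>.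
  rewrite exprS IH malgU_mul iterS; reflexivity.
have iterE (u : {cmonom K}) p i : (iter p (mmul u) mone : {cmonom K}) i = (p * u i)%N.
  by elim: p => [|p IH] /=; rewrite ?cm1 // cmM IH mulSn.
have prodE (f : K -> {cmonom K}) : \prod_(v <- r) << f v >> =
    << \big[mmul/mone]_(v <- r) f v >> :> {malg k[{cmonom K}]}.
  elim: {ur mr} r => [|v r IH]; first by rewrite !big_nil; congr << _ >>.
  rewrite !big_cons IH malgU_mul; reflexivity.
have bigE (f : K -> {cmonom K}) i :
    (\big[mmul/mone]_(v <- r) f v : {cmonom K}) i = (\sum_(v <- r) f v i)%N.
  by elim: {ur mr prodE} r => [|v r IH]; rewrite ?big_nil ?cm1 // !big_cons cmM IH.
under eq_bigr do rewrite powE.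
rewrite prodE; congr << _ >>; apply/eqP/cmP => i; rewrite bigE.
under eq_bigr do rewrite iterE cmU.
have [ir|ir] := boolP (i \in r); last first.
  rewrite mr // big_seq big1 // => v vr; case: eqP => [vi|_]; last by rewrite muln0.
  by rewrite -vi vr in ir.
rewrite (bigD1_seq i) //= eqxx muln1 big1 ?addn0 // => v vi.
by rewrite (negbTE vi) muln0.
Qed.

Variable n : nat.

Definition coord_var (v : 'I_n) : {malg k[{cmonom 'I_n}]} := << ucm v >>.

Definition cmonom_of (a : 'I_n -> nat) : {cmonom 'I_n} :=
  [cmonom a i | i in [fset i in 'I_n]%fset]%M.

Lemma cmonom_ofE a i : cmonom_of a i = a i.
Proof. by rewrite cmE fsfun_fun !inE. Qed.

Lemma mcoeff_prod_coord_var (a b : 'I_n -> nat) :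
  (\prod_v coord_var v ^+ a v)@_(cmonom_of b) = ([forall v, a v == b v])%:R.
Proof.
under eq_bigr do rewrite -(cmonom_ofE a).
rewrite prod_ucm; last 2 first.
- exact: index_enum_uniq.
- by move=> v; rewrite mem_index_enum.
rewrite mcoeffU1; congr (_ : bool)%:R; apply/eqP/forallP => [ab v|ab]; last first.
  by apply/eqP/cmP => v; rewrite !cmonom_ofE; apply/eqP.
by rewrite -[a v]cmonom_ofE ab cmonom_ofE.
Qed.

End MonomialAlgebra.

Section FacePoint.
Variables (n : nat) (B : comPzRingType) (coord_var : 'I_n -> B).
Variables (P : choiceType) (le : P -> P -> Prop).
Variables (supp : P -> {set 'I_n}) (rs : P -> {set 'I_n} -> P).
Hypothesis lab : simplicial_labelling le supp rs.

(** Restriction to the closed face [u]: everything outside the interval below [u] vanishes, and the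
    interval itself gives an ordinary polynomial ring in the vertices of [u]. *)
Definition face_point (u s : P) : B :=
  if `[< le s u >] then \prod_(v in supp s) coord_var v else 0.

(** At most one join of [s] and [t] lies below [u], so the sum has at most one nonzero term. When
    both lie below [u], what remains is that two sets, taken together as a multiset, equal their
    intersection and union taken together. *)
Lemma face_point_mul u s t m : (joins le s t !=set0 -> is_glb le s t m) ->
  face_point u s * face_point u t =
  face_point u m * \sum_(g <- (fset_set [set: P] : seq P) | `[< joins le s t g >]) face_point u g.
Proof.
move=> hm; rewrite /face_point.
case: (asboolP (le s u)) => su; last first.
  rewrite mul0r [X in _ = _ * X]big1 ?mulr0 // => g /asboolP[sg _ _].
  by case: asboolP => // /(slab_trans lab sg).
case: (asboolP (le t u)) => tu; last first.
  rewrite mulr0 [X in _ = _ * X]big1 ?mulr0 // => g /asboolP[_ tg _].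
  by case: asboolP => // /(slab_trans lab tg).
have jst := slab_join_rs lab su tu; set j := rs u _ in jst.
have ju : le j u by apply: (slab_rs_le lab); rewrite finset.subUset !(slab_le_supp lab).
have [ms mt mm] : is_glb le s t m by apply: hm; exists j.
have mu : le m u := slab_trans lab ms su.
rewrite asboolT // [X in _ = _ * X]big_mkcond (bigD1_seq j) ?fset_uniq ?(mem_slab lab) //=.
rewrite asboolT // asboolT // [X in _ + X]big1 ?addr0; last first.
  move=> g gj; case: asboolP => // gJ; case: asboolP => // gu; case/eqP: gj.
  have [_ _ gE] := (slab_joinsP lab _ _ _).1 gJ.
  have [_ _ jE] := (slab_joinsP lab _ _ _).1 jst.
  by apply: (slab_le_eq lab gu ju); rewrite gE jE.
have [_ _ jE] := (slab_joinsP lab _ _ _).1 jst.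
have mE : supp m = (supp s :&: supp t)%SET.
  have [_ _ gm] := slab_glb lab su tu.
  have sI : (supp s :&: supp t)%SET \subset supp s by apply: finset.subsetIl.
  apply/eqP; rewrite finset.eqEsubset finset.subsetI !(slab_le_supp lab) //=.
  rewrite -{1}(slab_supp lab sI); apply: (slab_le_supp lab); apply: mm.
    exact: (slab_rs_le lab).
  rewrite (slab_rs_leE lab su) // -(slab_rs_leE lab tu) ?finset.subsetIr //.
  by apply: (slab_rs_le lab); apply: finset.subsetIr.
rewrite jE mE !(big_mkcond (fun v => v \in _)) -!big_split /=.
apply: eq_bigr => v _; rewrite !inE.
by case: (v \in supp s); case: (v \in supp t) => /=; rewrite ?mul1r ?mulr1.
Qed.

Lemma face_point_bot u o : supp o = finset.set0 -> face_point u o = 1.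
Proof.
move=> o0; rewrite /face_point asboolT ?o0 ?big_set0 //.
exact: (slab_bot_le lab).
Qed.

Lemma face_point_monomial u s a : face_exponent supp s a ->
  face_monomial supp rs (face_point u) s a =
  if `[< le s u >] then \prod_v coord_var v ^+ a v else 0.
Proof.
move=> ae; rewrite /face_monomial {1}/face_point; case: asboolP => su; last by rewrite mul0r.
rewrite !(big_mkcond (fun v => v \in _)) -big_split /=; apply: eq_bigr => v _.
have := ae v; case: (boolP (v \in supp s)) => vs av; last first.
  by move: av; case: (a v) => // _; rewrite expr0 mulr1.
have v1 : [set v]%SET \subset supp s by rewrite finset.sub1set.
rewrite /face_point asboolT; last first.
  exact: (slab_trans lab (slab_rs_le lab v1)).
by rewrite (slab_supp lab v1) big_set1 -exprS prednK.
Qed.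

End FacePoint.

Lemma aclass_is_monoid_morphism (k : fieldType) (A : comAlgType k) (S : set A) :
  monoid_morphism (aclass S).
Proof. by split=> [|a b]; [|apply: aclassM]. Qed.

HB.instance Definition _ (k : fieldType) (A : comAlgType k) (S : set A) :=
  GRing.isMonoidMorphism.Build A (aquot S) (aclass S) (aclass_is_monoid_morphism S).

Lemma has_dim_fin (k : fieldType) (W : lmodType k) (U : set W) (I : finType) (b : I -> W) :
  (forall w, U w <-> exists c : I -> k, w = \sum_j c j *: b j) ->
  (forall c : I -> k, \sum_j c j *: b j = 0 -> forall j, c j = 0) ->
  has_dim U #|I|.
Proof.
move=> bs bf; exists (fun j => b (enum_val j)).
have reI (c : 'I_#|I| -> k) :
    \sum_(j < #|I|) c j *: b (enum_val j) = \sum_(i : I) c (enum_rank i) *: b i.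
  rewrite [RHS](reindex (@enum_val I I)); last exact: onW_bij (@enum_val_bij I).
  by apply: eq_bigr => j _; rewrite enum_valK.
split=> [w|c].
  rewrite bs; split=> -[c ->]; last by exists (c \o enum_rank); rewrite reI.
  exists (c \o enum_val); rewrite reI; apply: eq_bigr => i _ /=.
  by rewrite enum_rankK.
by rewrite reI => /bf c0 j; rewrite -[j]enum_valK c0.
Qed.

Section FaceRingRelations.
Variables (k : fieldType) (n : nat) (P : choiceType) (le : P -> P -> Prop).
Variables (supp : P -> {set 'I_n}) (rs : P -> {set 'I_n} -> P).
Hypothesis lab : simplicial_labelling le supp rs.

Let E := fset_set [set: P].
Let A := face_poly k P.
Let rel := @face_relations k P le.

Let memE s : s \in E. Proof. exact: mem_slab lab s. Qed.

Lemma face_mdegE (m : {cmonom P}) : face_mdeg le m = (\sum_(s <- E) m s * #|supp s|)%N.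
Proof.
rewrite /face_mdeg; under eq_bigr do rewrite (slab_prank lab).
apply: big_fset_incl => [|s _ sm]; first by apply/fsubsetP.
by move: sm; rewrite -cmE_eq0 => /eqP ->.
Qed.

Lemma face_mdegM (m1 m2 : {cmonom P}) :
  face_mdeg le (mmul m1 m2) = (face_mdeg le m1 + face_mdeg le m2)%N.
Proof.
by rewrite !face_mdegE -big_split; apply: eq_bigr => s _; rewrite cmM mulnDl.
Qed.

Lemma face_mdegU s : face_mdeg le (ucm s) = #|supp s|.
Proof.
rewrite face_mdegE (bigD1_seq s) ?fset_uniq //= cmUU mul1n big1 ?addn0 // => t ts.
by rewrite cmU eq_sym (negbTE ts).
Qed.

Lemma face_mdeg1 : face_mdeg le mone = 0%N.
Proof. by rewrite face_mdegE big1 // => s _; rewrite cm1. Qed.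

Lemma face_var_seq (m : {cmonom P}) : exists l : seq P,
  \prod_(t <- l) face_var k t = << m >> :> A /\
  face_mdeg le m = (\sum_(t <- l) #|supp t|)%N.
Proof.
exists (flatten [seq nseq (m s) s | s <- E]); split.
  rewrite big_flatten /= big_map -(@prod_ucm k P E m); last 2 first.
  - exact: fset_uniq.
  - by move=> v; rewrite memE.
  by apply: eq_bigr => s _; rewrite big_nseq iter_mulr_1.
rewrite face_mdegE big_flatten /= big_map; apply: eq_bigr => s _.
by rewrite big_nseq iter_addn_0 mulnC.
Qed.

(** A graded component is the image of the homogeneous polynomials, so a basis element needs a
    representative of known degree. Before passing to the quotient it is a single monomial: [s] has
    degree [#|supp s|] and the vertices add the shifted exponents. *)
Lemma face_monomial_malg s a : face_exponent supp s a ->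
  exists2 m, face_mdeg le m = (\sum_v a v)%N &
             face_monomial supp rs (@face_var k P) s a = << m >>.
Proof.
pose hom d (w : A) := exists2 m, face_mdeg le m = d & w = << m >>.
have homM d1 d2 w1 w2 : hom d1 w1 -> hom d2 w2 -> hom (d1 + d2)%N (w1 * w2).
  move=> [m1 <- ->] [m2 <- ->]; exists (mmul m1 m2); first exact: face_mdegM.
  exact: malgU_mul.
have hom1 : hom 0%N 1 by exists mone; [exact: face_mdeg1|congr << _ >>].
have homU t : hom #|supp t| (face_var k t) by exists (ucm t); [exact: face_mdegU|].
have homX d w p : hom d w -> hom (p * d)%N (w ^+ p).
  move=> hw; elim: p => [|p IH]; first by rewrite expr0 mul0n; exact: hom1.
  by rewrite exprS mulSn; apply: homM.
move=> ae; suff : hom (\sum_v a v)%N (face_monomial supp rs (@face_var k P) s a) by [].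
have -> : (\sum_v a v = #|supp s| + \sum_(v in supp s) (a v).-1)%N.
  rewrite -sum1_card !(big_mkcond (fun v => v \in _)) -big_split /=.
  by apply: eq_bigr => v _; rewrite -ae; case: (a v).
apply: (homM); first exact: (homU).
apply: (big_ind2 hom); [exact: hom1|by move=> *; apply: homM|].
move=> v vs; have hv : hom 1%N (face_var k (rs s [set v]%SET)).
  have v1 : [set v]%SET \subset supp s by rewrite finset.sub1set.
  by have := homU (rs s [set v]%SET); rewrite (slab_supp lab v1) cards1; apply.
by have := homX _ _ (a v).-1 hv; rewrite muln1; apply.
Qed.

Lemma aclass_face_monomial s a :
  aclass rel (face_monomial supp rs (@face_var k P) s a) =
  face_monomial supp rs (fun t => aclass rel (face_var k t)) s a.
Proof.
rewrite /face_monomial rmorphM rmorph_prod; congr (_ * _).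
by apply: eq_bigr => v _; rewrite rmorphXn.
Qed.

Let x (s : P) : face_ring k le := aclass rel (face_var k s).

Lemma face_ring_bot o : supp o = finset.set0 -> x o = 1.
Proof.
move=> o0; apply/eqP; rewrite -subr_eq0; apply/eqP.
apply: etrans (esym (raddfB (aclass rel) (face_var k o) 1)) _.
suff H : rel (face_var k o - 1) by apply: (@aclass_gen k A _ _ H).
by left; exists o; split=> // s; apply: (slab_bot_le lab).
Qed.

Lemma face_ring_mul_glb s t m : (joins le s t !=set0 -> is_glb le s t m) ->
  x s * x t = x m * \sum_(g <- (E : seq P) | `[< joins le s t g >]) x g.
Proof.
move=> hm; pose S := \sum_(g <- (E : seq P) | `[< joins le s t g >]) face_var k g.
have -> : \sum_(g <- (E : seq P) | `[< joins le s t g >]) x g = aclass rel S.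
  by apply: esym; apply: raddf_sum.
apply: etrans (aclass_mul _ _ _) _; apply: etrans _ (esym (aclass_mul _ _ _)).
apply/eqP; rewrite -subr_eq0; apply/eqP; apply: etrans (esym (raddfB _ _ _)) _.
suff H : rel (face_var k s * face_var k t - face_var k m * S).
  exact: (@aclass_gen k A _ _ H).
right; exists s, t, m; split; first exact: hm.
rewrite (slab_fsbig lab); reflexivity.
Qed.

End FaceRingRelations.

Lemma malg_eval (k : fieldType) (P : choiceType) (E : seq P) (S : comNzRingType)
    (f : {rmorphism k -> S}) (y : P -> S) : uniq E -> (forall s, s \in E) ->
  exists phi : {rmorphism {malg k[{cmonom P}]} -> S},
    (forall c p, phi (c *: p) = f c * phi p) /\ (forall s, phi (<< ucm s >>) = y s).
Proof.
move=> uE memE; pose h (m : {cmonom P}) : S := \prod_(s <- E) y s ^+ m s.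
have hM : mmorphism h.
  split=> [m1 m2|]; last by rewrite /h big1 // => s _; rewrite cm1 expr0.
  by rewrite /h -big_split; apply: eq_bigr => s _; rewrite cmM exprD.
pose hm := monalg.isMultiplicative.Build _ _ h hM.
pose H : {mmorphism {cmonom P} -> S} := HB.pack h hm.
exists (mmap f H); split=> [c p|s]; first exact: mmapZ.
apply: etrans (@mmapU _ _ _ f h 1 (ucm s)) _.
apply: etrans (congr1 (fun c => c * h (ucm s)) (rmorph1 f)) _.
rewrite mul1r /h (bigD1_seq s) //= cmUU expr1 big1 ?mulr1 // => t ts.
by rewrite cmU eq_sym (negbTE ts) expr0.
Qed.

Section FaceRingEvaluation.
Variables (k : fieldType) (n : nat) (P : choiceType) (le : P -> P -> Prop).
Variables (supp : P -> {set 'I_n}) (rs : P -> {set 'I_n} -> P).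
Hypothesis lab : simplicial_labelling le supp rs.

Let E := fset_set [set: P].
Let A := face_poly k P.
Let rel := @face_relations k P le.
Let B : comNzRingType := {malg k[{cmonom 'I_n}]}.

Let memE s : s \in E. Proof. exact: mem_slab lab s. Qed.

Lemma ideal_gen_ker (S : comNzRingType) (phi : {rmorphism A -> S}) (R : set A) p :
  (forall q, R q -> phi q = 0) -> ideal_gen R p -> phi p = 0.
Proof.
move=> R0 /(_ [set q | phi q = 0]); apply; split=> //; split; last first.
  by move=> a q /= q0; rewrite rmorphM q0 mulr0.
by split=> [|a b /= a0 b0]; rewrite /= ?rmorph0 // rmorphB a0 b0 subrr.
Qed.

(** A morphism out of the polynomial ring that kills the ideal does the work of a morphism out of
    the quotient; the relations hold in the target by [face_point_bot] and [face_point_mul]. *)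
Lemma face_point_morph (u : P) : exists phi : {rmorphism A -> B},
  [/\ forall c p, phi (c *: p) = malgC c * phi p,
      forall s, phi (face_var k s) = face_point (@coord_var k n) le supp u s &
      forall p, ideal_gen rel p -> phi p = 0].
Proof.
have [phi [phiZ phiU]] := malg_eval (@malgC {cmonom 'I_n} k)
  (face_point (@coord_var k n) le supp u) (fset_uniq E) memE.
have phiV s : phi (face_var k s) = face_point (@coord_var k n) le supp u s := phiU s.
exists phi; split; [exact: phiZ|exact: phiV|move=> p].
apply: ideal_gen_ker => q [[o [oP ->]]|[s [t [m [hm ->]]]]].
  have o0 : supp o = finset.set0.
    have [o' o'0] := slab_bot lab; have := oP o' => /(slab_le_supp lab).
    by rewrite o'0 finset.subset0 => /eqP.
  apply: etrans (rmorphB phi _ _) _.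
  apply: etrans (congr2 (fun a b => a - b) (phiV o) (rmorph1 phi)) _.
  apply: etrans (congr1 (fun a => a - 1) (face_point_bot _ lab u o0)) _.
  exact: subrr.
apply: etrans (rmorphB phi _ _) _.
apply/eqP; rewrite subr_eq0; apply/eqP.
apply: etrans (rmorphM phi _ _) _; apply: etrans _ (esym (rmorphM phi _ _)).
apply: etrans (congr2 *%R (phiV s) (phiV t)) _.
apply: etrans (face_point_mul _ lab u hm) _.
apply: congr2; first exact: esym (phiV m).
rewrite (slab_fsbig lab).
apply: etrans _ (esym (rmorph_sum phi _ _ _)).
apply: eq_bigr => g _; exact: esym (phiV g).
Qed.

End FaceRingEvaluation.

Lemma malgU_scale (k : fieldType) (K : monomType) (c : k) (m : K) :
  << c *g m >> = c *: << m >>.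
Proof. by apply/malgP => m'; rewrite mcoeffZ !mcoeffU mulrnAr mulr1. Qed.

(** * A monomial basis of the face ring *)

Section FaceRingBasis.
Variables (k : fieldType) (n : nat) (P : choiceType) (le : P -> P -> Prop).
Variables (supp : P -> {set 'I_n}) (rs : P -> {set 'I_n} -> P).
Hypothesis lab : simplicial_labelling le supp rs.

Let E := fset_set [set: P].
Let A := face_poly k P.
Let rel := @face_relations k P le.

Let memE s : s \in E. Proof. exact: mem_slab lab s. Qed.
Let x (s : P) : face_ring k le := aclass rel (face_var k s).

(** Exponents that sum to [i] are at most [i], so taking them in ['I_i.+1] loses nothing and makes
    the index type finite. *)
Definition face_index (i : nat) : finType :=
  {q : E * {ffun 'I_n -> 'I_i.+1} |
    [forall v, (0 < q.2 v)%N == (v \in supp (val q.1))] && (\sum_v q.2 v == i)%N}.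

Definition findex_elt i (j : face_index i) : P := val (val j).1.
Definition findex_exp i (j : face_index i) (v : 'I_n) : nat := (val j).2 v.

Lemma findex_expP i (j : face_index i) : face_exponent supp (findex_elt j) (findex_exp j).
Proof. by move=> v; case/andP: (valP j) => /forallP/(_ v)/eqP. Qed.

Lemma findex_sum i (j : face_index i) : (\sum_v findex_exp j v)%N = i.
Proof. by case/andP: (valP j) => _ /eqP. Qed.

Lemma findex_inj i (j1 j2 : face_index i) : findex_elt j1 = findex_elt j2 ->
  (forall v, findex_exp j1 v = findex_exp j2 v) -> j1 = j2.
Proof.
move=> /val_inj e12 a12; apply: val_inj; rewrite [LHS]surjective_pairing [RHS]surjective_pairing.
by rewrite e12; congr pair; apply/ffunP => v; apply: val_inj; apply: a12.
Qed.

Lemma findex_ex i s (a : 'I_n -> nat) : face_exponent supp s a -> (\sum_v a v)%N = i ->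
  exists j : face_index i, findex_elt j = s /\ forall v, findex_exp j v = a v.
Proof.
move=> ae ai; have ale v : (a v < i.+1)%N by rewrite ltnS -ai (bigD1 v) //= leq_addr.
pose q : E * {ffun 'I_n -> 'I_i.+1} := ([` memE s]%fset, [ffun v => Ordinal (ale v)]).
have qP : [forall v, (0 < q.2 v)%N == (v \in supp (val q.1))] && (\sum_v q.2 v == i)%N.
  apply/andP; split; first by apply/forallP => v; rewrite ffunE /= ae.
  by apply/eqP; rewrite -[RHS]ai; apply: eq_bigr => v _; rewrite ffunE.
by exists (exist _ q qP); split=> // v; rewrite /findex_exp /= ffunE.
Qed.

Let pmon i (j : face_index i) : A :=
  face_monomial supp rs (@face_var k P) (findex_elt j) (findex_exp j).

Let e i (j : face_index i) : face_ring k le := aclass rel (pmon j).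

Lemma face_basis_combination i (c : face_index i -> k) :
  \sum_j c j *: e j = aclass rel (\sum_j c j *: pmon j).
Proof.
apply: etrans _ (esym (raddf_sum (aclass rel) _ _ _)).
apply: eq_bigr => j _; exact: esym (aclassZ rel (c j) (pmon j)).
Qed.

(** Restriction to the face of [j0], followed by the coefficient at the exponent of [j0], isolates
    [c j0]: elements not below this face vanish, and an element below it is determined by its
    support, hence by its exponent vector. *)
Lemma face_basis_free i (c : face_index i -> k) :
  \sum_j c j *: e j = 0 -> forall j, c j = 0.
Proof.
rewrite face_basis_combination => c0 j0.
have {c0} : ideal_gen rel (\sum_j c j *: pmon j).
  rewrite -[X in ideal_gen _ X]subr0; apply/aclass_eq; rewrite c0.
  exact: esym (raddf0 (aclass rel)).
have [phi [phiZ phiV phi0]] := face_point_morph k lab (findex_elt j0).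
have phiE i' (j : face_index i') : phi (pmon j) =
    face_monomial supp rs (face_point (@coord_var k n) le supp (findex_elt j0))
      (findex_elt j) (findex_exp j).
  apply: etrans (rmorphM phi _ _) _; apply: congr2; first exact: phiV.
  apply: etrans (rmorph_prod phi _ _ _) _; apply: eq_bigr => v _.
  apply: etrans (rmorphXn phi _ _) _; rewrite phiV; reflexivity.
have coefE j : mcoeff (cmonom_of (findex_exp j0)) (phi (c j *: pmon j)) =
    c j * ((j == j0)%:R).
  rewrite phiZ mcoeffCM; congr (_ * _).
  rewrite phiE (face_point_monomial _ lab) ?findex_expP //; last exact: findex_expP.
  case: asboolP => [le_j|nle]; last first.
    rewrite mcoeff0; case: eqP => // jj0; case: nle; rewrite jj0.
    exact: (slab_refl lab).
  rewrite mcoeff_prod_coord_var; congr (_ : bool)%:R.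
  apply/forallP/eqP => [aa|->//]; apply: findex_inj => [|v]; last exact/eqP.
  apply: (slab_le_eq lab le_j (slab_refl lab _)); apply/setP => v.
  by rewrite -!findex_expP (eqP (aa v)).
move=> /phi0 pc0; pose mc := mcoeff (cmonom_of (findex_exp j0)) : _ -> k.
have H : \sum_j c j * (j == j0)%:R = 0 :> k.
  apply: etrans (eq_bigr _ (fun j _ => esym (coefE j))) _.
  apply: etrans (esym (raddf_sum mc _ _ _)) _.
  apply: etrans (congr1 mc (esym (rmorph_sum phi _ _ _))) _.
  apply: etrans (congr1 mc pc0) _; exact: raddf0.
rewrite -[RHS]H (bigD1 j0) //= eqxx mulr1 big1 ?addr0 // => j /negbTE ->.
by rewrite mulr0.
Qed.

Lemma face_basis_span i w : face_comp i w <-> exists c : face_index i -> k, w = \sum_j c j *: e j.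
Proof.
split=> [[p ph <-]|[c ->]]; last first.
  exists (\sum_j c j *: pmon j); last exact: esym (face_basis_combination c).
  move=> m; rewrite -mcoeff_neq0 raddf_sum /=.
  have [//|mi] := eqVneq (face_mdeg le m) i; rewrite big1 ?eqxx // => j _.
  have [m' m'd m'E] := face_monomial_malg k lab (findex_expP j).
  rewrite mcoeffZ [pmon j]m'E mcoeffU1; case: eqP => [mm|_]; last by rewrite mulr0.
  by rewrite -mm m'd findex_sum eqxx in mi.
pose sp w := exists c : face_index i -> k, w = \sum_j c j *: e j.
have sp0 : sp 0 by exists (fun=> 0); rewrite big1 // => j _; rewrite scale0r.
have spD w1 w2 : sp w1 -> sp w2 -> sp (w1 + w2).
  move=> [c1 ->] [c2 ->]; exists (fun j => c1 j + c2 j); rewrite -big_split /=.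
  by apply: eq_bigr => j _; rewrite scalerDl.
have spZ a w1 : sp w1 -> sp (a *: w1).
  move=> [c1 ->]; exists (fun j => a * c1 j); rewrite scaler_sumr.
  by apply: eq_bigr => j _; rewrite scalerA.
have spe (j : face_index i) : sp (e j).
  exists (fun j' : face_index i => (j' == j)%:R); rewrite (bigD1 j) //= eqxx scale1r big1 ?addr0 //.
  by move=> j' /negbTE ->; rewrite scale0r.
(* A monomial is a product of variables, and [face_monomial_span] rewrites the class of such a
   product as a sum of basis elements of the same degree. *)
have spm m : face_mdeg le m = i -> sp (aclass rel << m >>).
  move=> mi; have [l [lE ld]] := face_var_seq k lab m.
  have [L [Lv LE]] := face_monomial_span lab (face_ring_bot k lab) (face_ring_mul_glb k lab) l.
  have -> : aclass rel << m >> = \prod_(t <- l) x t.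
    rewrite -lE; exact: (rmorph_prod (aclass rel)).
  rewrite LE big_seq; apply: (big_ind sp) => // q qL.
  have [qe qs] := Lv q qL; have [j [js jv]] := findex_ex qe (etrans qs (etrans (esym ld) mi)).
  suff -> : face_monomial supp rs x q.1 q.2 = e j by [].
  apply: etrans _ (esym (aclass_face_monomial _ _ _ _ _ _)).
  rewrite js /face_monomial; congr (_ * _).
  by apply: eq_bigr => v _; rewrite jv.
have -> : aclass rel p = \sum_(m <- msupp p) p@_m *: aclass rel << m >>.
  rewrite {1}[p]monalgE; apply: etrans (raddf_sum (aclass rel) _ _ _) _.
  apply: eq_bigr => m _; apply: etrans _ (aclassZ _ _ _).
  rewrite (malgU_scale p@_m m); reflexivity.
rewrite big_seq; apply: (big_ind sp) => // m mp; apply: spZ; apply: spm; exact: ph.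
Qed.

Lemma face_comp_dim i : has_dim (@face_comp k P le i) #|face_index i|.
Proof.
apply: (has_dim_fin (b := @e i)); [exact: face_basis_span|exact: face_basis_free].
Qed.

End FaceRingBasis.

(** * Counting monomials *)

(** The series X / (1 - X) cut off after X^N. *)
Definition pos_geom (N : nat) : {poly rat} := \sum_(j < N.+1 | (0 < j)%N) 'X^j.

(** The factor of an index collects its admissible exponents: 1 to [N] on [A], only 0 off [A].
    Distributing the product over these sums enumerates the exponent vectors by their total. *)
Lemma card_exponent (n N i : nat) (A : {set 'I_n}) :
  (#|[pred a : {ffun 'I_n -> 'I_N.+1} |
      [forall v, (0 < a v)%N == (v \in A)] && (\sum_v a v == i)%N]|)%:R
  = (pos_geom N ^+ #|A|)`_i.
Proof.
have -> : pos_geom N ^+ #|A| =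
    \prod_(v < n) \sum_(j < N.+1) (if (0 < j)%N == (v \in A) then 'X^j else 0).
  rewrite -prodr_const big_mkcond; apply: eq_bigr => v _; rewrite -big_mkcond /=.
  case: (v \in A); first by apply: eq_bigl => j; rewrite eqb_id.
  rewrite (eq_bigl (fun j => j == ord0)) => [|j]; last by rewrite lt0n -val_eqE eqbF_neg negbK.
  by rewrite big_pred1_eq expr0.
rewrite bigA_distr_bigA /= coef_sum -sum1_card natr_sum big_mkcond.
apply: eq_bigr => a _; rewrite inE.
have [aA|] := boolP [forall v, (0 < a v)%N == (v \in A)].
  have -> : \prod_(v < n) (if (0 < a v)%N == (v \in A) then 'X^(a v) else 0) =
      'X^(\sum_v a v) :> {poly rat}.
    by rewrite expr_sum; apply: eq_bigr => v _; rewrite (forallP aA v).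
  by rewrite coefXn eq_sym /=; case: eqP.
rewrite negb_forall => /existsP[v /negbTE va].
by rewrite [\prod_(_ < _) _](bigD1 v) //= va mul0r coef0.
Qed.

(** Congruence modulo X^(N + 1). *)
Definition coef_agree (N : nat) (p q : {poly rat}) : Prop :=
  forall i, (i <= N)%N -> p`_i = q`_i.

Lemma coef_agreeM N p q p' q' : coef_agree N p q -> coef_agree N p' q' ->
  coef_agree N (p * p') (q * q').
Proof.
move=> pq pq' i iN; rewrite !coefM; apply: eq_bigr => j _.
have ji : (j <= i)%N by rewrite -ltnS.
by rewrite pq ?pq' // (leq_trans _ iN) // leq_subr.
Qed.

Lemma coef_agreeX N p q m : coef_agree N p q -> coef_agree N (p ^+ m) (q ^+ m).
Proof.
by move=> pq; elim: m => [|m IH]; rewrite ?expr0 // !exprS; apply: coef_agreeM.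
Qed.

Lemma coef_pos_geom N i : (pos_geom N)`_i = (0 < i <= N)%N%:R.
Proof.
rewrite coef_sum; under eq_bigr do rewrite coefXn.
have [iN|iN] := leqP i N; last first.
  rewrite andbF big1 // => j _; case: eqP => // ij.
  by have := ltn_ord j; rewrite -ij ltnS leqNgt iN.
rewrite andbT big_mkcond (bigD1 (inord i)) //= inordK ?ltnS // eqxx big1 ?addr0.
  by case: (0 < i)%N.
move=> j ji; case: (0 < j)%N => //; case: eqP => // ij; case/eqP: ji.
by apply: val_inj; rewrite /= inordK.
Qed.

Lemma pos_geom_agree N N' : (N <= N')%N -> coef_agree N (pos_geom N) (pos_geom N').
Proof.
by move=> NN i iN; rewrite !coef_pos_geom iN (leq_trans iN NN).
Qed.

Lemma pos_geomM N : coef_agree N ((1 - 'X) * pos_geom N) 'X.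
Proof.
move=> i iN; rewrite mulrBl mul1r coefB coefXM !coef_pos_geom coefX iN andbT.
by case: i iN => [|[|i]] //= iN; rewrite ?subr0 // (ltnW iN) subrr.
Qed.

(** The truncation order moves with the coefficient, because the count in degree [i] uses
    [pos_geom i]. All orders may be raised to [i] without changing the coefficients involved; then
    [m] of the [r] factors 1 - X cancel the denominators of X / (1 - X). *)
Lemma pos_geom_series (r m i : nat) : (m <= r)%N ->
  \sum_(j < i.+1) ((1 - 'X) ^+ r)`_j * (pos_geom (i - j) ^+ m)`_(i - j) =
  ('X^m * (1 - 'X) ^+ (r - m))`_i.
Proof.
move=> mr; transitivity (((1 - 'X) ^+ r * pos_geom i ^+ m)`_i).
  rewrite coefM; apply: eq_bigr => j _; congr (_ * _).
  exact: (coef_agreeX _ (pos_geom_agree (leq_subr j i))).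
have -> : (1 - 'X) ^+ r * pos_geom i ^+ m =
    ((1 - 'X) * pos_geom i) ^+ m * (1 - 'X) ^+ (r - m).
  by rewrite exprMn mulrAC -exprD subnKC.
by apply: (coef_agreeM (coef_agreeX _ (@pos_geomM i)) (q' := (1 - 'X) ^+ (r - m))).
Qed.

Section FaceIndexCount.
Variables (n : nat) (P : choiceType) (supp : P -> {set 'I_n}).
Hypothesis finP : finite_set [set: P].

Lemma card_face_index i :
  (#|face_index supp i|)%:R = \sum_(A : {set 'I_n})
     (#|` fset_set [set s | supp s = A]|)%:R * (pos_geom i ^+ #|A|)`_i :> rat.
Proof.
pose E := fset_set [set: P].
rewrite card_sig -sum1_card natr_sum /=.
transitivity (\sum_(s : E) (pos_geom i ^+ #|supp (val s)|)`_i).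
  rewrite (partition_big (fun q : E * {ffun 'I_n -> 'I_i.+1} => q.1) xpredT) //=.
  apply: eq_bigr => s _; rewrite -card_exponent -natr_sum sum1_card; congr _%:R.
  rewrite -[RHS](card_imset _ (f := fun a => (s, a))); last by move=> a b [].
  apply: eq_card => -[s' a]; apply/andP/imsetP => /=.
    by move=> [ha /eqP <-]; exists a.
  by move=> [b hb [-> ->]]; rewrite eqxx.
rewrite (partition_big (fun s : E => supp (val s)) xpredT) //=.
apply: eq_bigr => A _; rewrite (eq_bigr (fun=> (pos_geom i ^+ #|A|)`_i)); last first.
  by move=> s /eqP ->.
rewrite (sumr_const [pred s : E | supp (val s) == A]) mulr_natl; congr (_ *+ _).
have -> : fset_set [set s | supp s = A] =
    [fset val s | s in [pred s : E | supp (val s) == A]]%fset.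
  have fA : finite_set [set s | supp s = A] by apply: sub_finite_set finP.
  apply/fsetP => s; rewrite in_fset_set //; apply/idP/imfsetP => /=.
    rewrite inE /= => sA; have sE : s \in E by rewrite in_fset_set // inE.
    by exists [` sE]%fset => //; apply/eqP.
  by move=> [s' s'A ->]; rewrite inE /=; apply/eqP.
by rewrite card_imfset /= ?cardE //; exact: val_inj.
Qed.
End FaceIndexCount.

(** * Finitely generated abelian groups *)

Lemma isog_sym (V W : zmodType) : isog V W -> isog W V.
Proof.
move=> [f [g fg gf]]; have ga : zmod_morphism g.
  by move=> x y; apply: (can_inj fg); rewrite raddfB !gf.
pose gM := GRing.isZmodMorphism.Build _ _ g ga.
pose G : {additive W -> V} := HB.pack g gM.
by exists G; exists f.
Qed.

Lemma isog_trans (V W X : zmodType) : isog V W -> isog W X -> isog V X.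
Proof.
move=> [f bf] [g bg]; exists (g \o f); exact: bij_comp.
Qed.

Lemma subgroup_ker (V W : zmodType) (f : {additive V -> W}) : is_subgroup [set u | f u = 0].
Proof.
split=> [|x y fx fy]; first exact: (raddf0 f).
by apply: etrans (raddfB f x y) _; rewrite [f x]fx [f y]fy subrr.
Qed.

Lemma isog_ker2 (U V W : zmodType) (f : {additive U -> V}) (g : {additive U -> W}) :
  (forall v, exists u, f u = v) -> (forall w, exists u, g u = w) ->
  (forall u, f u = 0 <-> g u = 0) -> isog V W.
Proof.
move=> fs gs fg; pose S := [set u | f u = 0].
have SE u : f u = 0 <-> subgroup_gen S u.
  split=> [|/(_ S)]; first by move=> fu; apply: sub_gen.
  by apply; split=> //; apply: subgroup_ker.
apply: isog_trans (isog_sym (isog_ker fs SE)) (isog_ker gs _).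
by move=> u; rewrite -fg SE.
Qed.

Lemma zrank_isog (V W : zmodType) : isog V W -> zrank V = zrank W.
Proof.
move=> VW; rewrite /zrank; congr xget; apply/seteqP; split=> d [G h]; exists G.
  exact: isog_trans (isog_sym VW) h.
exact: isog_trans VW h.
Qed.

Lemma isog_torsion (V W : zmodType) : isog V W -> isog (torsion V) (torsion W).
Proof.
move=> VW; have [f [g fg gf]] := VW; have [g' bg'] := isog_sym VW.
have ga : zmod_morphism g.
  by move=> x y; apply: (can_inj fg); rewrite raddfB !gf.
pose gM := GRing.isZmodMorphism.Build _ _ g ga.
pose G : {additive W -> V} := HB.pack g gM.
exists (torsion_map f); exists (torsion_map G) => x; apply: val_inj => /=.
  exact: fg.
exact: gf.
Qed.

Lemma card_fset_setT_bij (T U : choiceType) (f : T -> U) :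
  bijective f -> #|` fset_set [set: T]| = #|` fset_set [set: U]|.
Proof.
move=> [g fg gf]; have [fT|nfT] := pselect (finite_set [set: T]); last first.
  have nfU : ~ finite_set [set: U].
    move=> fU; apply: nfT; have -> : [set: T] = g @` [set: U].
      by apply/seteqP; split=> // x _; exists (f x).
    exact: finite_image.
  (* On an infinite set [fset_set] takes its default value, the empty set, so both counts are 0. *)
  by rewrite /fset_set; do 2 case: pselect => //.
have -> : [set: U] = f @` [set: T].
  by apply/seteqP; split=> // x _; exists (g x).
by rewrite fset_set_image // card_imfset //; apply: can_inj fg.
Qed.

Lemma tcard_isog (V W : zmodType) : isog V W -> tcard V = tcard W.
Proof. by move=> /isog_torsion[f bf]; apply: card_fset_setT_bij bf. Qed.

Lemma card_fset_setT_fin (T : choiceType) (I : finType) (f : I -> T) :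
  bijective f -> #|` fset_set [set: T]| = #|I|.
Proof.
move=> bf; rewrite -(card_fset_setT_bij bf).
have -> : fset_set [set: I] = [fset x | x in I]%fset.
  by apply/fsetP => x; apply/idP/imfsetP => _; [exists x|rewrite (in_fset_set finite_finset) inE].
by rewrite card_imfset //= cardE.
Qed.

Lemma finite_setT_bij (T : Type) (I : finType) (f : I -> T) :
  bijective f -> finite_set [set: T].
Proof.
move=> [g fg gf]; have -> : [set: T] = f @` [set: I].
  by apply/seteqP; split=> // x _; exists (g x).
exact: finite_image.
Qed.

Section FiniteZmodule.
Variables (T : zmodType) (finT : finite_set [set: T]).

(* The unused [finT] makes the proof a parameter, so that instances may depend on it. *)
Definition fin_zmod : Type := let _ := finT in T.

HB.instance Definition _ := GRing.Zmodule.on fin_zmod.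

Let s : seq fin_zmod := fset_set [set: T].
Let mem_s (x : fin_zmod) : x \in s.
Proof. by rewrite /s in_fset_set // inE. Qed.

Let fin_zmod_pcancel : pcancel (fun x : fin_zmod => index x s) (fun i => onth s i).
Proof. by move=> x; rewrite /= onthE (nth_map 0) ?index_mem // nth_index. Qed.

HB.instance Definition _ := PCanIsCountable fin_zmod_pcancel.

Let fin_zmod_enumP : Finite.axiom s.
Proof. by move=> x; rewrite count_uniq_mem ?mem_s // /s fset_uniq. Qed.

HB.instance Definition _ := isFinite.Build fin_zmod fin_zmod_enumP.

End FiniteZmodule.

Lemma finite_zmod_isog (T : zmodType) : finite_set [set: T] ->
  exists G : finZmodType, isog T G.
Proof. by move=> finT; exists (fin_zmod finT); exists idfun; exists id. Qed.


(** * Invariance of the free rank *)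

Lemma ratmx_clear_denom p (v : 'rV[rat]_p) :
  exists (N : int) (w : 'rV[int]_p), N != 0 /\ N%:~R *: v = ratmx w.
Proof.
exists (\prod_j denq (v 0 j)).
exists (\row_j (numq (v 0 j) * \prod_(i | i != j) denq (v 0 i))); split.
  by apply/prodf_neq0 => j _; apply: denq_neq0.
apply/rowP => j; rewrite !mxE (bigD1 j) //= !intrM mulrAC; congr (_ * _); rewrite mulrC.
by rewrite -{1}[v 0 j]divq_num_den divfK // intr_eq0 denq_neq0.
Qed.

Lemma ratmx_row_free p m (B : 'M[int]_(p, m)) :
  (forall c : 'rV[int]_p, c *m B = 0 -> c = 0) -> row_free (ratmx B).
Proof.
move=> Bf; apply: inj_row_free => v vB; have [N [w [N0 Nw]]] := ratmx_clear_denom v.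
have /Bf w0 : w *m B = 0.
  have : ratmx (w *m B) = 0 by rewrite map_mxM -Nw -scalemxAl vB scaler0.
  move=> /matrixP h; apply/matrixP => i j; have := h i j.
  by rewrite [LHS]mxE [RHS]mxE => /eqP; rewrite intr_eq0 => /eqP ->; rewrite mxE.
move: Nw; rewrite w0 map_mx0 => /eqP; rewrite scaler_eq0 intr_eq0 (negbTE N0).
by move/eqP.
Qed.

Lemma additive_rV_mx (d m : nat) (f : {additive 'rV[int]_d -> 'rV[int]_m}) u :
  f u = u *m (\matrix_i f (delta_mx 0 i)).
Proof.
rewrite {1}[u]row_sum_delta raddf_sum mulmx_sum_row; apply: eq_bigr => j _.
by rewrite rowK -[u 0 j]intz !scaler_int raddfMz.
Qed.

Lemma injective_rV_leq (d m : nat) (f : {additive 'rV[int]_d -> 'rV[int]_m}) :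
  (forall u, f u = 0 -> u = 0) -> (d <= m)%N.
Proof.
move=> f0; have : row_free (ratmx (\matrix_i f (delta_mx 0 i))).
  by apply: ratmx_row_free => c; rewrite -additive_rV_mx; apply: f0.
by rewrite /row_free => /eqP <-; apply: rank_leq_col.
Qed.

Lemma finZmod_mulrn (G : finZmodType) (x : G) : exists2 N, (0 < N)%N & x *+ N = 0.
Proof.
have /injectivePn : ~~ injectiveb (fun i : 'I_#|G|.+1 => x *+ i).
  apply/negP => /injectiveP/leq_card; rewrite card_ord ltnn //.
case=> i [j ij xij]; wlog lij : i j ij xij / (i < j)%N.
  move=> H; have [|ji|/val_inj e] := ltngtP i j; first exact: H.
    by apply: (H j i) => //; rewrite eq_sym.
  by rewrite e eqxx in ij.
exists (j - i)%N; first by rewrite subn_gt0.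
by rewrite mulrnBr ?(ltnW lij) // xij subrr.
Qed.

Lemma finZmod_exponent (G : finZmodType) : exists2 N, (0 < N)%N & forall x : G, x *+ N = 0.
Proof.
have ex (x : G) := cid2 (finZmod_mulrn x).
exists (\prod_x s2val (ex x))%N.
  by apply: prodn_gt0 => x; case: (ex x).
by move=> x; rewrite (bigD1 x) //= mulrnA; case: (ex x) => N _ /= ->; rewrite mul0rn.
Qed.

(** The component from Z^d to Z^m is injective: if it kills [u], the image of [u] lies in [H], so a
    multiple of [u] by the exponent of [H] is sent to 0, and Z^d has no torsion. *)
Lemma free_rank_leq (d m : nat) (G H : finZmodType) :
  isog ('rV[int]_d * G)%type ('rV[int]_m * H)%type -> (d <= m)%N.
Proof.
move=> [f [g fg _]]; have [N N0 NH] := finZmod_exponent H.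
pose h (u : 'rV[int]_d) : 'rV[int]_m := (f (u, 0)).1.
have ha : zmod_morphism h.
  move=> x y; rewrite /h -[(f (x, 0)).1 - _]/((f (x, 0) - f (y, 0)).1) -raddfB.
  by congr (f _).1; congr pair; rewrite subr0.
pose hM := GRing.isZmodMorphism.Build _ _ h ha.
pose F : {additive 'rV[int]_d -> 'rV[int]_m} := HB.pack h hM.
apply: (@injective_rV_leq _ _ F) => u hu.
have fu : f ((u, 0) *+ N) = 0.
  rewrite raddfMn [f _]surjective_pairing [X in (X, _)]hu.
  have pMn (a : 'rV[int]_m) (b : H) k : (a, b) *+ k = (a *+ k, b *+ k).
    by elim: k => // k IH; rewrite !mulrS IH.
  by rewrite pMn mul0rn NH.
have : (u, 0 : G) *+ N = 0 by apply: (can_inj fg); rewrite fu raddf0.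
move/(congr1 fst); have -> : forall k, ((u, 0 : G) *+ k).1 = u *+ k.
  by elim=> // k IH; rewrite !mulrS -IH.
move=> uN; apply/rowP => j; move/rowP/(_ j): uN; rewrite !mxE => /eqP.
by rewrite mulmxnE mulrn_eq0 gtn_eqF //= => /eqP.
Qed.

(** [zrank] is a choice among the possible ranks; [free_rank_leq] in both directions shows that
    there is only one. *)
Lemma zrankE (V : zmodType) (d : nat) (G : finZmodType) :
  isog V ('rV[int]_d * G)%type -> zrank V = d.
Proof.
move=> Vd; rewrite /zrank.
have [H Hx] : [set d | exists G : finZmodType, isog V ('rV[int]_d * G)%type]
   (xget 0%N [set d | exists G : finZmodType, isog V ('rV[int]_d * G)%type]).
  by apply: (xgetI 0%N (x := d)); exists G.
by apply/eqP; rewrite eqn_leq; apply/andP; split;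
  [apply: free_rank_leq (isog_trans (isog_sym Hx) Vd)
  |apply: free_rank_leq (isog_trans (isog_sym Vd) Hx)].
Qed.

(** * Cokernels and the Smith normal form *)

Definition cokernel_of p m (V : zmodType) (f : {additive 'rV[int]_m -> V})
    (B : 'M[int]_(p, m)) : Prop :=
  (forall v, exists u, f u = v) /\
  (forall u, f u = 0 <-> exists c : 'rV[int]_p, u = c *m B).

(* V = Z^m / (d_0 Z + ... + d_(rho - 1) Z); a zero divisor stands for a free
   summand, as 0 %| u means u = 0. *)
Definition diag_pres m (V : zmodType) (g : {additive 'rV[int]_m -> V})
    (rho : nat) (d : nat -> nat) : Prop :=
  (forall v, exists u, g u = v) /\
  (forall u, g u = 0 <->
     forall j : 'I_m, ((if (j < rho)%N then d j else 0%N)%:Z %| u 0%R j)%Z).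

(** The zeros of the diagonal come from the cut at [rho] alone. This allows [d] to be nowhere zero,
    and [rho] is then the rank whenever it fits into the matrix. *)
Definition smith_mx p m (rho : nat) (d : nat -> int) : 'M[int]_(p, m) :=
  \matrix_(i, j) (d i *+ ((i == j :> nat) && (i < rho)%N)).

Lemma tr_smith_mx p m rho d : (smith_mx p m rho d)^T = smith_mx m p rho d.
Proof.
apply/matrixP => i j; rewrite !mxE eq_sym; case: eqP => //= ij.
by rewrite ij.
Qed.

Lemma smith_mx_diag p m rho d :
  smith_mx p m rho d = diag_mx (\row_i d i) *m pid_mx rho.
Proof.
by apply/matrixP => i j; rewrite mul_diag_mx !mxE mulr_natr.
Qed.

Lemma smith_mx_rowP p m rho d (u : 'rV[int]_m) : (rho <= p)%N -> (forall i, d i != 0) ->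
  (exists c : 'rV[int]_p, u = c *m smith_mx p m rho d) <->
  forall j : 'I_m, ((if (j < rho)%N then `|d j|%N else 0%N)%:Z %| u 0%R j)%Z.
Proof.
move=> rp d0.
have cE (c : 'rV[int]_p) (j : 'I_m) (jr : (j < rho)%N) :
    (c *m smith_mx p m rho d) 0 j = c 0 (Ordinal (leq_trans jr rp)) * d j.
  rewrite mxE (bigD1 (Ordinal (leq_trans jr rp))) //= mxE eqxx jr mulr1n big1 ?addr0 //.
  move=> i ij; rewrite mxE; case: eqP => [e|_]; last by rewrite mulr0.
  by case/eqP: ij; apply: val_inj.
have c0 (c : 'rV[int]_p) (j : 'I_m) : ~~ (j < rho)%N -> (c *m smith_mx p m rho d) 0 j = 0.
  move=> jr; rewrite mxE big1 // => i _; rewrite mxE.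
  by case: eqP => [->|_]; rewrite ?(negbTE jr) mulr0.
split=> [[c ->] j|du].
  case: ifPn => jr; last by rewrite c0 // dvdz0.
  by rewrite cE dvdzE absz_nat abszM dvdn_mull.
exists (\row_i if insub (val i) is Some j then (u 0%R j %/ d i)%Z else 0).
apply/rowP => j; have := du j; case: ifPn => jr; last by rewrite c0 // dvd0z => /eqP.
have jK : insub (j : nat) = Some j :> option 'I_m by rewrite valK.
by rewrite cE mxE /= jK => h; rewrite divzK // dvdzE; move: h; rewrite dvdzE absz_nat.
Qed.

Lemma smith_cokernel p m rho d (L : 'M[int]_p) (U : 'M[int]_m) (V : zmodType)
    (f : {additive 'rV[int]_m -> V}) :
  (rho <= p)%N -> (forall i, d i != 0) -> L \in unitmx -> U \in unitmx ->
  cokernel_of f (L *m smith_mx p m rho d *m U) ->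
  exists g : {additive 'rV[int]_m -> V}, diag_pres g rho (fun i => `|d i|%N).
Proof.
move=> rp d0 Lu Uu [fs fk]; exists (f \o mulmxr U); split=> [v|u].
  by have [u <-] := fs v; exists (u *m invmx U); rewrite /= mulmxKV.
rewrite /= fk -(smith_mx_rowP (p := p)) //; split=> -[c ue].
  by exists (c *m L); rewrite -[LHS](mulmxK Uu) ue !mulmxA mulmxK.
by exists (c *m invmx L); rewrite ue !mulmxA mulmxKV.
Qed.

Lemma smith_form p m (B : 'M[int]_(p, m)) : exists rho d (L : 'M[int]_p) (U : 'M[int]_m),
  [/\ (rho <= p)%N, (rho <= m)%N, forall i, d i != 0, L \in unitmx /\ U \in unitmx &
      B = L *m smith_mx p m rho d *m U].
Proof.
have [L Lu [U Uu [s ss ->]]] := int_Smith_normal_form B.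
pose r0 := find (pred1 0) s.
(* In a divisibility chain every entry after a zero is zero, and so is the default past the end of
   [s]; hence the nonzero entries are exactly those before the first zero. *)
have s0 i : (s`_i == 0) = ~~ (i < r0)%N.
  rewrite -leqNgt; apply/idP/idP => [/eqP si|ri]; last first.
    have [is_|is_] := ltnP i (size s); last by rewrite nth_default.
    have hs : has (pred1 0) s by rewrite has_find (leq_ltn_trans ri).
    have := nth_find 0 hs => /= /eqP z0.
    have := sorted_leq_nth (@dvdz_trans) (@dvdzz) 0 ss => /(_ r0 i).
    rewrite !inE => /(_ (leq_ltn_trans ri is_) is_ ri).
    by rewrite z0 dvd0z.
  by rewrite leqNgt; apply/negP => /(before_find 0) /=; rewrite si eqxx.
(* The list [s] may be longer than the diagonal, hence the minima. Zero entries are replaced by 1,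
   which is harmless since they lie past the cut. *)
exists (minn r0 (minn p m)), (fun i => if s`_i == 0 then 1 else s`_i), L, U; split.
- by rewrite geq_min geq_min leqnn /= orbT.
- by rewrite geq_min geq_min leqnn !orbT.
- by move=> i; case: ifPn.
- by [].
congr (_ *m _ *m _); apply/matrixP => i j; rewrite !mxE; case: eqP => //= ij.
have ipm : (i < minn p m)%N by rewrite leq_min ltn_ord ij ltn_ord.
have := s0 i; rewrite leq_min ipm andbT; case: (i < r0)%N => /= h; rewrite h //.
exact/eqP.
Qed.

Lemma ratmx_unit p (L : 'M[int]_p) : L \in unitmx -> ratmx L \in unitmx.
Proof.
move=> Lu; have : ratmx L *m ratmx (invmx L) = 1%:M by rewrite -map_mxM mulmxV // map_mx1.
by case/mulmx1_unit.
Qed.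

Lemma rank_smith_mx p m rho d (L : 'M[int]_p) (U : 'M[int]_m) :
  (rho <= p)%N -> (rho <= m)%N -> (forall i, d i != 0) -> L \in unitmx -> U \in unitmx ->
  \rank (ratmx (L *m smith_mx p m rho d *m U)) = rho.
Proof.
move=> rp rm d0 Lu Uu; rewrite smith_mx_diag !map_mxM mxrankMfree; last first.
  by rewrite row_free_unit ratmx_unit.
rewrite eqmxMfull; last by rewrite row_full_unit ratmx_unit.
rewrite eqmxMfull; last first.
  rewrite row_full_unit unitmxE map_diag_mx det_diag unitfE; apply/prodf_neq0 => i _.
  by rewrite !mxE intr_eq0.
by rewrite map_pid_mx rank_pid_mx.
Qed.

(** Transposing L D U gives U^T D^T L^T, and D^T has the same diagonal as D. The same [d] therefore
    serves both cokernels, which is why a group and its dual have equally large torsion. *)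
Lemma smith_pres p m (B : 'M[int]_(p, m)) : exists d : nat -> nat,
  [/\ forall i, (0 < d i)%N,
      forall (V : zmodType) (f : {additive 'rV[int]_m -> V}), cokernel_of f B ->
        exists g : {additive 'rV[int]_m -> V}, diag_pres g (\rank (ratmx B)) d &
      forall (V : zmodType) (f : {additive 'rV[int]_p -> V}), cokernel_of f B^T ->
        exists g : {additive 'rV[int]_p -> V}, diag_pres g (\rank (ratmx B)) d].
Proof.
have [rho [d [L [U [rp rm d0 [Lu Uu] ->]]]]] := smith_form B.
rewrite rank_smith_mx //; exists (fun i => `|d i|%N); split=> [i|V f|V f].
- by rewrite absz_gt0.
- exact: smith_cokernel.
by rewrite !trmx_mul tr_smith_mx mulmxA; apply: smith_cokernel; rewrite ?unitmx_tr.
Qed.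

Section DiagTorsion.
Variables (m : nat) (V : zmodType) (g : {additive 'rV[int]_m -> V}).
Variables (rho : nat) (d : nat -> nat).
Hypotheses (dp : diag_pres g rho d) (rm : (rho <= m)%N) (d0 : forall i, (0 < d i)%N).

Let gs := dp.1.
Let gk := dp.2.
Let wid (i : 'I_rho) : 'I_m := widen_ord rm i.

Lemma diag_pres_torsion u :
  g u \in torsion_pred V <-> forall j : 'I_m, (rho <= j)%N -> u 0 j = 0.
Proof.
split=> [/asboolP[N N0 Nu] j rj|u0].
  have /gk/(_ j) : g (u *+ N) = 0 by rewrite raddfMn.
  rewrite ltnNge rj /= dvd0z mulmxnE => /eqP.
  by move/eqP; rewrite mulrn_eq0 gtn_eqF //= => /eqP.
apply/asboolP; exists (\prod_(i < rho) d i)%N; first by apply: prodn_gt0.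
rewrite -raddfMn; apply/gk => j; rewrite mulmxnE; case: ltnP => jr; last first.
  by rewrite u0 // mul0rn dvdz0.
rewrite (bigD1 (Ordinal jr)) //= mulrnA -mulr_natr dvdzE abszM dvdn_mulr //.
by rewrite -mulr_natr natz abszM absz_nat dvdn_mull.
Qed.

Definition diag_residue := {dffun forall i : 'I_rho, 'I_(d i)}.

Lemma card_diag_residue : #|diag_residue| = (\prod_(i < rho) d i)%N.
Proof.
rewrite card_dep_ffun foldrE big_map big_enum /=.
by apply: eq_bigr => i _; rewrite card_ord.
Qed.

Definition residue_row (a : diag_residue) : 'rV[int]_m :=
  \row_j (if insub (j : nat) is Some i then (a i : nat)%:Z else 0).

Lemma residue_row_wid a i : residue_row a 0 (wid i) = (a i : nat)%:Z.
Proof. by rewrite mxE /=; have -> : insub (i : nat) = Some i by rewrite valK. Qed.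

Lemma residue_row_out a (j : 'I_m) : (rho <= j)%N -> residue_row a 0 j = 0.
Proof. by move=> rj; rewrite mxE insubN // -leqNgt. Qed.

Lemma residue_row_torsion a : g (residue_row a) \in torsion_pred V.
Proof. by apply/diag_pres_torsion => j; apply: residue_row_out. Qed.

Definition residue_torsion a : torsion V := Torsion (residue_row_torsion a).

Lemma residue_torsion_bij : bijective residue_torsion.
Proof.
have inj : injective residue_torsion.
  move=> a b /(congr1 (@torsion_val V)) /= ab; apply/ffunP => i; apply: val_inj => /=.
  have /gk/(_ (wid i)) : g (residue_row a - residue_row b) = 0 by rewrite raddfB ab subrr.
  rewrite /= ltn_ord mxE [X in _ + X]mxE !residue_row_wid -eqz_mod_dvd.
  by rewrite !modz_small ?ltz_nat ?ltn_ord // => /eqP [].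
have surj x : exists a, residue_torsion a = x.
  have [u gu] := gs (torsion_val x).
  have u0 : forall j : 'I_m, (rho <= j)%N -> u 0 j = 0.
    by apply/diag_pres_torsion; rewrite gu; case: x {gu}.
  have lt i : (`|(u 0%R (wid i) %% d i)%Z|%N < d i)%N.
    by rewrite -ltz_nat gez0_abs ?ltz_pmod ?modz_ge0 // ?ltz_nat // -lt0n.
  exists [ffun i => Ordinal (lt i)]; apply: val_inj; rewrite /= -gu.
  apply/eqP; rewrite -subr_eq0 -raddfB; apply/eqP/gk => j.
  rewrite mxE [X in _ + X]mxE; case: ltnP => rj; last by rewrite residue_row_out // u0.
  have -> : j = wid (Ordinal rj) by apply: val_inj.
  rewrite residue_row_wid ffunE /= gez0_abs ?modz_ge0 // -?lt0n //.
  by rewrite -eqz_mod_dvd modz_mod.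
exists (fun x => sval (cid (surj x))) => [a|x]; last by case: cid.
by apply: inj; case: cid.
Qed.

Lemma diag_pres_tcard : tcard V = (\prod_(i < rho) d i)%N.
Proof. by rewrite -card_diag_residue; apply: card_fset_setT_fin residue_torsion_bij. Qed.

Lemma diag_pres_torsion_finite : finite_set [set: torsion V].
Proof. exact: finite_setT_bij residue_torsion_bij. Qed.

(** The coordinates below [rho] carry the torsion and the remaining ones are free; [g] and the map
    that separates the two kinds are surjections from Z^m with the same kernel. *)
Lemma diag_pres_structure : exists G : finZmodType, isog V ('rV[int]_(m - rho) * G)%type.
Proof.
have [G TG] := finite_zmod_isog diag_pres_torsion_finite.
suff VW : isog V ('rV[int]_(m - rho) * torsion V)%type.
  have [h bh] := TG; exists G; apply: isog_trans VW _.
  pose k (x : 'rV[int]_(m - rho) * torsion V) : 'rV[int]_(m - rho) * G := (x.1, h x.2).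
  have ka : zmod_morphism k by move=> x y; rewrite /k /= raddfB.
  pose kM := GRing.isZmodMorphism.Build _ _ k ka.
  pose K : {additive ('rV[int]_(m - rho) * torsion V)%type -> ('rV[int]_(m - rho) * G)%type} := HB.pack k kM.
  have [h' hh' h'h] := bh; exists K; exists (fun x => (x.1, h' x.2)) => -[x y] /=.
    by rewrite /k /= hh'.
  by rewrite /k /= h'h.
pose hd (u : 'rV[int]_m) : 'rV[int]_m := \row_j (if (j < rho)%N then u 0 j else 0).
have hdB u v : hd (u - v) = hd u - hd v.
  by apply/rowP => j; rewrite !mxE; case: ifP; rewrite ?subrr.
have ltj (j : 'I_(m - rho)) : (rho + j < m)%N by rewrite -ltn_subRL.
have ht u : g (hd u) \in torsion_pred V.
  by apply/diag_pres_torsion => j rj; rewrite mxE ltnNge rj.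
pose phi (u : 'rV[int]_m) : 'rV[int]_(m - rho) * torsion V :=
  (\row_j u 0 (Ordinal (ltj j)), Torsion (ht u)).
have pa : zmod_morphism phi.
  move=> u v; rewrite /phi; congr pair; first by apply/rowP => j; rewrite !mxE.
  by apply: val_inj; rewrite /= hdB raddfB.
pose pM := GRing.isZmodMorphism.Build _ _ phi pa.
pose Phi : {additive 'rV[int]_m -> ('rV[int]_(m - rho) * torsion V)%type} := HB.pack phi pM.
apply: (isog_ker2 (f := g) (g := Phi)) => // [[w [t tt]]|u].
  have [u gu] := gs t; have u0 := (diag_pres_torsion u).1; rewrite gu in u0.
  exists (\row_j (if insub (j - rho)%N is Some i then
                    if (j < rho)%N then u 0 j else w 0 i else u 0 j)).
  rewrite /= /phi; congr pair.
    by apply/rowP => j; rewrite !mxE /= addKn valK ltnNge leq_addr.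
  apply: val_inj; rewrite /= -gu; congr (g _); apply/rowP => j; rewrite !mxE.
  case: ltnP => jr; last by rewrite u0.
  by case: insub.
split=> [gu|pu].
  have k0 := (gk u).1 gu.
  have u0 (j : 'I_m) : (rho <= j)%N -> u 0 j = 0.
    by move=> rj; have := k0 j; rewrite ltnNge rj dvd0z => /eqP.
  rewrite /= /phi; congr pair; first by apply/rowP => j; rewrite !mxE u0 //= leq_addr.
  apply: val_inj => /=; rewrite -[RHS]gu; congr (g _); apply/rowP => j; rewrite mxE.
  by case: ltnP => // jr; rewrite u0.
have /rowP w0 := congr1 fst pu; have hu := congr1 (fun x => torsion_val x.2) pu.
have k0 := (gk (hd u)).1 hu; apply/gk => j; have := k0 j; rewrite !mxE; case: ltnP => // jr _.
have jl : (j - rho < m - rho)%N by rewrite ltn_sub2r // (leq_ltn_trans jr).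
have := w0 (Ordinal jl); rewrite !mxE => uj; rewrite dvd0z -[X in _ == X]uj; apply/eqP.
by congr (u _ _); apply: val_inj; rewrite /= subnKC.
Qed.

Lemma diag_pres_zrank : zrank V = (m - rho)%N.
Proof. by have [G /zrankE] := diag_pres_structure. Qed.

End DiagTorsion.

(** * Characters of the torsion subgroup *)

Lemma closed_prim_root (C : numClosedFieldType) n : (0 < n)%N ->
  exists w : C, n.-primitive_root w.
Proof.
pose p : {poly C} := 'X^n - 1; have [r Dp] := closed_field_poly_normal p.
move=> n_gt0; rewrite (monicP _) ?monicXnsubC // scale1r in Dp.
have rn1 : all n.-unity_root r by apply/allP=> z; rewrite -root_prod_XsubC -Dp.
have sz_r : (n < (size r).+1)%N.
  by rewrite -(size_prod_XsubC r id) -Dp size_XnsubC.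
(* A list of n distinct n-th roots of unity contains a primitive one; the roots are distinct because
   X^n - 1 is separable in characteristic 0. *)
have [|z] := hasP (has_prim_root n_gt0 rn1 _ sz_r); last by exists z.
by rewrite -separable_prod_XsubC -Dp separable_Xn_sub_1 // pnatr_eq0 -lt0n.
Qed.

Section CharacterTheory.
Variables (R : realType) (G : zmodType).
Implicit Types chi : character R G.

Lemma char_inj chi1 chi2 : (forall x, chi1 x = chi2 x) -> chi1 = chi2.
Proof.
case: chi1 chi2 => [f f0 fD] [h h0 hD] /= fh; have {}fh : f = h by apply/funext.
by case: h / fh h0 hD => h0 hD; congr Character; apply: Prop_irrelevance.
Qed.

Lemma char0 chi : chi 0 = 1.
Proof.
apply: (mulfI (char_neq0 chi 0)); rewrite -charD addr0 mulr1 //.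
Qed.

Lemma charN chi x : chi (- x) = (chi x)^-1.
Proof.
by apply: (mulfI (char_neq0 chi x)); rewrite -charD subrr char0 divff // char_neq0.
Qed.

Lemma char_mulrn chi x k : chi (x *+ k) = chi x ^+ k.
Proof. by elim: k => [|k IH]; rewrite ?mulr0n ?char0 // mulrS charD IH exprS. Qed.

Lemma char_mulrz chi x (k : int) : chi (x *~ k) = chi x ^ k.
Proof.
by case: k => k; rewrite ?NegzE ?mulrNz ?charN -pmulrn char_mulrn // -exprnN.
Qed.

Lemma char_sum chi (I : Type) (r : seq I) (F : I -> G) :
  chi (\sum_(i <- r) F i) = \prod_(i <- r) chi (F i).
Proof. exact: (big_morph chi (charD chi) (char0 chi)). Qed.

End CharacterTheory.

Section DiagCharacters.
Variables (R : realType) (m : nat) (V : zmodType) (g : {additive 'rV[int]_m -> V}).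
Variables (rho : nat) (d : nat -> nat).
Hypotheses (dp : diag_pres g rho d) (rm : (rho <= m)%N) (d0 : forall i, (0 < d i)%N).

Let gs := dp.1.
Let gk := dp.2.
Let wid (i : 'I_rho) : 'I_m := widen_ord rm i.
Let w (i : nat) : R[i] := sval (cid (closed_prim_root R[i] (d0 i))).
Let wP i : (d i).-primitive_root (w i).
Proof. by rewrite /w; case: cid. Qed.
Let w0 i : w i != 0.
Proof.
apply: contraTneq (oner_neq0 R[i]) => wi; rewrite -(prim_expr_order (wP i)) wi.
by rewrite expr0n gtn_eqF // eqxx.
Qed.

(** The i-th basis vector goes to [w i ^+ a i]. The map is built on Z^m, where additivity is
    immediate, and descends along [g] because [w i] has order [d i]. *)
Let X (a : diag_residue rho d) (u : 'rV[int]_m) : R[i] :=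
  \prod_(i < rho) (w i ^+ a i) ^ (u 0%R (wid i)).

Let X0 a u : X a u != 0.
Proof. by apply/prodf_neq0 => i _; rewrite expfz_neq0 // expf_neq0. Qed.

Let XD a u v : X a (u + v) = X a u * X a v.
Proof.
rewrite /X -big_split; apply: eq_bigr => i _; rewrite mxE expfzDr //.
by rewrite expf_neq0.
Qed.

Let Xker a u : g u = 0 -> X a u = 1.
Proof.
move=> /gk uk; rewrite /X big1 // => i _; have := uk (wid i); rewrite /= ltn_ord.
case/dvdzP => q ->; rewrite mulrC -exprz_exp -exprnP -exprM mulnC exprM.
by rewrite (prim_expr_order (wP i)) expr1n exp1rz.
Qed.

Let X_eq a u v : g u = g v -> X a u = X a v.
Proof.
move=> uv; have : X a (u - v) = 1 by apply: Xker; rewrite raddfB uv subrr.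
move=> h; rewrite -[u](subrK v) XD h mul1r //.
Qed.

Let lift (x : V) := sval (cid (gs x)).
Let liftK x : g (lift x) = x.
Proof. by rewrite /lift; case: cid. Qed.

Let chi_subproof a x y : X a (lift (torsion_val (x + y))) =
  X a (lift (torsion_val x)) * X a (lift (torsion_val y)).
Proof. by rewrite -XD; apply: X_eq; rewrite raddfD !liftK. Qed.

Definition residue_char (a : diag_residue rho d) : character R (torsion V) :=
  Character (fun x => X0 a (lift (torsion_val x))) (chi_subproof a).

Lemma residue_charE a u (ut : g u \in torsion_pred V) :
  residue_char a (Torsion ut) = X a u.
Proof. by apply: X_eq; rewrite liftK. Qed.

(** The torsion is generated by the classes of the first [rho] basis vectors, the i-th of which is
    killed by [d i]. A character thus amounts to choosing for every i a root of unity of order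
    dividing [d i], that is a power of [w i]. *)
Lemma residue_char_bij : bijective residue_char.
Proof.
have tt (i : 'I_rho) : g (delta_mx 0 (wid i)) \in torsion_pred V.
  apply/(diag_pres_torsion dp d0) => j rj; rewrite mxE; case: eqP => // ji.
  by case: eqP => // ji'; move: rj; rewrite ji' leqNgt /= ltn_ord.
pose T i := Torsion (tt i).
have XT a (i : 'I_rho) : X a (delta_mx 0 (wid i)) = w i ^+ a i.
  rewrite /X (bigD1 i) //= mxE !eqxx expr1z big1 ?mulr1 // => j ji.
  rewrite mxE eqxx /=; case: eqP => [/(congr1 val) e|_]; last by rewrite expr0z.
  by case/eqP: ji; apply: val_inj.
have inj : injective residue_char.
  move=> a b ab; apply/ffunP => i; apply: val_inj => /=.
  have : residue_char a (T i) = residue_char b (T i) by rewrite ab.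
  rewrite !residue_charE !XT => /eqP.
  by rewrite (eq_prim_root_expr (wP i)) !modn_small // => /eqP.
have surj chi : exists a, residue_char a = chi.
  have Ti (i : 'I_rho) : chi (T i) ^+ d i = 1.
    rewrite -char_mulrn -(char0 chi); congr (chi _); apply: val_inj.
    rewrite raddfMn /= -raddfMn; apply/gk => j; rewrite mulmxnE mxE eqxx /=.
    case: eqP => [->|_]; last by rewrite mul0rn dvdz0.
    by rewrite /= ltn_ord -[_ *+ d i]/((d i)%:R : int) natz dvdzz.
  pose a : diag_residue rho d := [ffun i : 'I_rho => sval (prim_rootP (wP i) (Ti i))].
  have aE (i : 'I_rho) : chi (T i) = w i ^+ a i by rewrite ffunE; case: prim_rootP.
  exists a; apply: char_inj => -[x tx]; have [u gu] := gs x.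
  case: x / gu tx => tx; rewrite residue_charE.
  have u0 := (diag_pres_torsion dp d0 u).1 tx.
  have -> : Torsion tx = \sum_i T i *~ u 0%R (wid i).
    apply: val_inj; rewrite raddf_sum.
    under eq_bigr do rewrite raddfMz /= -raddfMz.
    rewrite -raddf_sum; congr (g _); apply/rowP => j; rewrite summxE.
    have [jr|jr] := ltnP j rho; last first.
      rewrite u0 // big1 // => i _; rewrite -scaler_int !mxE eqxx /=.
      case: eqP => [e|_]; last by rewrite mulr0.
      by move: jr; rewrite e leqNgt /= ltn_ord.
    rewrite (bigD1 (Ordinal jr)) //= -scaler_int !mxE eqxx /=.
    have -> : (j == wid (Ordinal jr)) by apply/eqP/val_inj.
    rewrite mulr1 big1 ?addr0; last first.
      move=> i ij; rewrite -scaler_int !mxE eqxx /=; case: eqP => [e|_]; last by rewrite mulr0.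
      by case/eqP: ij; apply: val_inj; rewrite /= e.
    by rewrite intz; congr (u _ _); apply: val_inj.
  by rewrite char_sum; apply: eq_bigr => i _; rewrite char_mulrz aE.
exists (fun x => sval (cid (surj x))) => [a|x]; last by case: cid.
by apply: inj; case: cid.
Qed.

End DiagCharacters.

Lemma cokernel_zrank p m (V : zmodType) (f : {additive 'rV[int]_m -> V}) (B : 'M[int]_(p, m)) :
  cokernel_of f B -> zrank V = (m - \rank (ratmx B))%N.
Proof.
have [d [d0 hB _]] := smith_pres B => /hB[g gd].
by apply: diag_pres_zrank gd _ d0; apply: rank_leq_col.
Qed.

Lemma cokernel_tr_tcard p m (V W : zmodType) (f : {additive 'rV[int]_m -> V})
    (h : {additive 'rV[int]_p -> W}) (B : 'M[int]_(p, m)) :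
  cokernel_of f B -> cokernel_of h B^T -> tcard V = tcard W.
Proof.
have [d [d0 hB hBT]] := smith_pres B => /hB[g gd] /hBT[g' gd'].
rewrite (diag_pres_tcard gd) ?(diag_pres_tcard gd') // ?rank_leq_col //.
exact: rank_leq_row.
Qed.

Lemma cokernel_exists m (V : zmodType) (f : {additive 'rV[int]_m -> V}) :
  (forall v, exists u, f u = v) -> exists p (B : 'M[int]_(p, m)), cokernel_of f B.
Proof.
move=> fs; have [p [B [BE _]]] := subgroup_rV_basis (subgroup_ker f).
by exists p, B; split.
Qed.

Lemma fg_cover (V : zmodType) : fin_gen V ->
  exists m (f : {additive 'rV[int]_m -> V}), forall v, exists u, f u = v.
Proof.
move=> fgV; have [p] := presentation_exists (n := 0) (fun=> 0 : V) fgV.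
by exists (pres_gens p), (pres_map p); apply: pres_surj.
Qed.

Lemma fg_diag_pres (V : zmodType) : fin_gen V -> exists m (g : {additive 'rV[int]_m -> V}) rho d,
  [/\ diag_pres g rho d, (rho <= m)%N & forall i, (0 < d i)%N].
Proof.
move=> /fg_cover[m [f /cokernel_exists[p [B fB]]]].
have [d [d0 /(_ _ _ fB)[g gd] _]] := smith_pres B.
by exists m, g, (\rank (ratmx B)), d; split=> //; apply: rank_leq_col.
Qed.

Lemma fg_torsion_fin (V : zmodType) : fin_gen V ->
  exists (I : finType) (f : I -> torsion V), bijective f /\ #|I| = tcard V.
Proof.
move=> /fg_diag_pres[m [g [rho [d [gd rm d0]]]]].
exists (diag_residue rho d), (residue_torsion gd d0); split.
  exact: (residue_torsion_bij gd rm d0).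
by rewrite (diag_pres_tcard gd rm d0) card_diag_residue.
Qed.

Lemma fg_char_fin (R : realType) (V : zmodType) : fin_gen V ->
  exists (I : finType) (f : I -> character R (torsion V)), bijective f /\ #|I| = tcard V.
Proof.
move=> /fg_diag_pres[m [g [rho [d [gd rm d0]]]]].
exists (diag_residue rho d), (residue_char R gd rm d0); split.
  exact: residue_char_bij.
by rewrite (diag_pres_tcard gd rm d0) card_diag_residue.
Qed.

Lemma fg_structure (V : zmodType) : fin_gen V ->
  exists G : finZmodType, isog V ('rV[int]_(zrank V) * G)%type.
Proof.
move=> /fg_diag_pres[m [g [rho [d [gd rm d0]]]]]; rewrite (diag_pres_zrank gd rm d0).
exact: (diag_pres_structure gd rm d0).
Qed.

(* Clearing denominators, the relations of V and of W span the same rational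
   subspace. *)
Lemma zrank_torsion_quot (V W : zmodType) (h : {additive V -> W}) : fin_gen V ->
  (forall w, exists v, h v = w) -> (forall v, h v = 0 -> v \in torsion_pred V) ->
  zrank V = zrank W.
Proof.
move=> /fg_cover[m [f fs]] hs hk.
have hfs w : exists u, (h \o f) u = w.
  by have [v <-] := hs w; have [u <-] := fs v; exists u.
have [p [B fB]] := cokernel_exists fs; have [p' [B' fB']] := cokernel_exists hfs.
rewrite (cokernel_zrank fB) (cokernel_zrank fB'); congr (_ - _)%N.
have rowE q (C : 'M[int]_(q, m)) i : exists c : 'rV[int]_q, row i C = c *m C.
  by exists (delta_mx 0 i); rewrite rowE.
apply/eqP; rewrite eqn_leq; apply/andP; split; apply: mxrankS; apply/row_subP => i.
  have /fB.2 fi := rowE _ B i.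
  have /fB'.2[c ci] : (h \o f) (row i B) = 0 by rewrite /= fi raddf0.
  by rewrite -map_row ci map_mxM submxMl.
have /fB'.2/hk/asboolP[N N0] := rowE _ B' i.
rewrite -raddfMn => /fB.2[c ci]; rewrite -map_row.
have N0' : N%:R != 0 :> rat by rewrite pnatr_eq0 -lt0n.
have -> : ratmx (row i B') = N%:R^-1 *: (ratmx c *m ratmx B).
  rewrite -map_mxM -ci; apply/rowP => j.
  rewrite !mxE mulmxnE !mxE rmorphMn /= -[X in _ = _ * X]mulr_natl mulKf //.
by rewrite scalemx_sub // submxMl.
Qed.

(** * Ranks and torsion of realizations *)

Lemma raddf_scalez m (V : zmodType) (f : {additive 'rV[int]_m -> V}) (a : int) u :
  f (a *: u) = f u *~ a.
Proof. by rewrite -{1}[a]intz scaler_int raddfMz. Qed.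

Lemma subgroup_gen_sum (n : nat) (V : zmodType) (z : 'I_n -> V) (A : {set 'I_n}) v :
  subgroup_gen [set z i | i in [set` A]] v <->
  exists c : 'I_n -> int, v = \sum_(i in A) z i *~ c i.
Proof.
split=> [|[c ->]]; last first.
  rewrite big_mkcond /=.
  rewrite (eq_bigr (fun i => (if i \in A then z i else 0) *~ c i)); last first.
    by move=> i _; case: ifP; rewrite ?mul0rz.
  apply: (is_subgroup_sumz _ _ (subgroup_genP _)) => i; case: ifPn => iA.
    by apply: sub_gen; exists i.
  by have [] := subgroup_genP [set z i | i in [set` A]].
move: v; apply: gen_min => [|_ [i iA <-]].
  split; first by exists (fun=> 0); rewrite big1.
  move=> _ _ [c ->] [c' ->]; exists (fun i => c i - c' i).
  by rewrite -sumrB; apply: eq_bigr => i _; rewrite mulrzBr.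
exists (fun j => (j == i)%:Z); rewrite (bigD1 i) //= eqxx mulr1z big1 ?addr0 //.
by move=> j /andP[_ /negbTE ->].
Qed.

Section PresentedRank.
Variables (n : nat) (V : zmodType) (z : 'I_n -> V) (p : presentation z).
Local Notation m := (pres_gens p).
Local Notation k := (pres_rels p).
Implicit Types A B C : {set 'I_n}.

(** Rows outside [A] are set to zero instead of being deleted, so that the matrices for all [A] have
    one shape: they can be compared by rank, and their transposes act on the same Z^(n + k) as the
    dual. *)
Definition sub_lift A : 'M[int]_(n, m) :=
  \matrix_i (if i \in A then row i (pres_lift p) else 0).

Definition sub_mx A : 'M[int]_(n + k, m) := col_mx (sub_lift A) (pres_rel p).

Lemma row_sub_lift A i : row i (sub_lift A) = if i \in A then row i (pres_lift p) else 0.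
Proof. by rewrite rowK. Qed.

Lemma sub_mx_cokernel A : cokernel_of (gclass [set z i | i in [set` A]] \o pres_map p) (sub_mx A).
Proof.
split=> [q|u].
  by have [u uq] := pres_surj p (grepr q); exists u; rewrite /= uq greprK.
rewrite /= gclass0 subgroup_gen_sum; split=> [[c uc]|[c ->]].
  pose cA := \row_i (if i \in A then c i else 0).
  have : pres_map p (u - cA *m pres_lift p) = 0.
    rewrite raddfB uc mulmx_sum_row raddf_sum [X in X - _]big_mkcond -sumrB big1 // => i _.
    rewrite mxE; case: ifP => _; last by rewrite scale0r raddf0 subrr.
    by rewrite raddf_scalez pres_liftP subrr.
  case/pres_ker => c' uc'; exists (row_mx cA c'); rewrite mul_row_col -uc' addrC.
  rewrite -{1}[u](subrK (cA *m pres_lift p)); congr (_ + _).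
  rewrite !mulmx_sum_row; apply: eq_bigr => i _; rewrite row_sub_lift mxE.
  by case: ifP; rewrite ?scale0r ?scaler0.
exists (fun i => lsubmx c 0 i); rewrite -{1}[c]hsubmxK mul_row_col raddfD /=.
have -> : pres_map p (rsubmx c *m pres_rel p) = 0 by apply/pres_ker; exists (rsubmx c).
rewrite addr0 mulmx_sum_row raddf_sum [RHS]big_mkcond; apply: eq_bigr => i _.
rewrite row_sub_lift; case: ifP => _; last by rewrite scaler0 raddf0.
by rewrite raddf_scalez pres_liftP.
Qed.

Definition sub_rank A : nat := \rank (ratmx (sub_mx A)).

Lemma zquot_zrank A : zrank (zquot z A) = (m - sub_rank A)%N.
Proof. exact: cokernel_zrank (sub_mx_cokernel A). Qed.

Lemma sub_rank_leq A : (sub_rank A <= m)%N.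
Proof. exact: rank_leq_col. Qed.

Lemma zquot0_isog : isog V (zquot z finset.set0).
Proof.
apply: isog_sym; apply: (isog_ker (f := idfun)) => [v|v]; first by exists v.
rewrite subgroup_gen_sum; split=> /= [v0|[c ->]]; last by rewrite big_set0.
by exists (fun=> 0); rewrite big_set0.
Qed.

Lemma pres_zrank : zrank V = (m - sub_rank finset.set0)%N.
Proof. by rewrite (zrank_isog zquot0_isog) zquot_zrank. Qed.

Lemma sub_rankS A B : A \subset B -> (sub_rank A <= sub_rank B)%N.
Proof.
move=> AB; apply: mxrankS; rewrite !map_col_mx col_mx_sub.
apply/andP; split; last by rewrite -addsmxE addsmxSr.
apply/row_subP => i; rewrite -map_row row_sub_lift; case: ifPn => iA.
  have -> : row i (pres_lift p) = row i (sub_lift B).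
    by rewrite row_sub_lift (fintype.subsetP AB).
  by rewrite map_row -addsmxE; apply: submx_trans (addsmxSl _ _); apply: row_sub.
by rewrite map_mx0 sub0mx.
Qed.

Lemma sub_rankU1 A b : (sub_rank (b |: A) <= (sub_rank A).+1)%N.
Proof.
have le : (ratmx (sub_mx (b |: A)) <= ratmx (sub_mx A) + ratmx (row b (pres_lift p)))%MS.
  rewrite {1}map_col_mx col_mx_sub; apply/andP; split; last first.
    by apply: submx_trans (addsmxSl _ _); rewrite map_col_mx -addsmxE addsmxSr.
  apply/row_subP => i; rewrite -map_row row_sub_lift !inE.
  have [->|ib] := eqVneq i b; first by rewrite /= addsmxSr.
  case: ifPn => /= iA; last by rewrite map_mx0 sub0mx.
  apply: submx_trans (addsmxSl _ _); rewrite map_col_mx -addsmxE.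
  apply: submx_trans (addsmxSl _ _).
  have -> : row i (pres_lift p) = row i (sub_lift A) by rewrite row_sub_lift iA.
  by rewrite map_row row_sub.
apply: leq_trans (mxrankS le) _; apply: leq_trans (mxrank_adds_leqif _ _) _.
by rewrite -[(sub_rank A).+1]addn1 leq_add2l rank_leq_row.
Qed.

Lemma sub_rank_card A B : A \subset B -> (sub_rank B <= sub_rank A + #|B :\: A|)%N.
Proof.
move=> AB; suff H C : (sub_rank (A :|: C) <= sub_rank A + #|C :\: A|)%N.
  by have := H B; rewrite (elimT finset.setUidPr AB).
elim/finset_ind: C => [|b C bC IH]; first by rewrite finset.setU0 finset.set0D cards0 addn0.
have [bA|bA] := boolP (b \in A).
  have -> : A :|: (b |: C) = A :|: C.
    by rewrite finset.setUCA; apply/finset.setUidPr; rewrite finset.sub1set inE bA.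
  apply: leq_trans IH _; rewrite leq_add2l subset_leq_card // finset.setSD //.
  exact: finset.subsetUr.
rewrite finset.setUCA; apply: leq_trans (sub_rankU1 _ _) _.
have -> : (b |: C) :\: A = b |: (C :\: A).
  by apply/setP => i; rewrite !inE; case: eqP => //= ->; rewrite bA.
by rewrite cardsU1 !inE (negbTE bC) andbF add1n addnS ltnS.
Qed.

Lemma pres_indepE A : (zrank V - zrank (zquot z A) == #|A|)%N =
  (sub_rank A == sub_rank finset.set0 + #|A|)%N.
Proof.
have := sub_rankS (finset.sub0set A); have := sub_rank_leq A.
by rewrite pres_zrank zquot_zrank; lia.
Qed.

(** The rank grows by at most one per added element, so growth by #B over the empty set leaves no
    slack on the way through [A]. *)
Lemma pres_indepS A B : A \subset B -> (zrank V - zrank (zquot z B) == #|B|)%N ->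
  (zrank V - zrank (zquot z A) == #|A|)%N.
Proof.
move=> AB; rewrite !pres_indepE => /eqP rB; apply/eqP.
have := sub_rank_card AB; have := sub_rank_card (finset.sub0set A).
rewrite finset.setD0 cardsD (elimT finset.setIidPr AB) => h1 h2.
by have := subset_leq_card AB; lia.
Qed.

End PresentedRank.

Lemma torsion_predP (V : zmodType) (v : V) :
  v \in torsion_pred V <-> exists2 k : nat, (0 < k)%N & v *+ k = 0.
Proof. by split=> /asboolP. Qed.

Section ReducedGroup.
Variables (n : nat) (V : zmodType) (z : 'I_n -> V).
Hypothesis fgV : fin_gen V.
Implicit Types A B : {set 'I_n}.

Local Notation Vr := (red_group V).
Local Notation zr := (red_vec z).
Local Notation cl := (gclass [set v | v \in torsion_pred V]).

Lemma red_class0 v : cl v = 0 <-> v \in torsion_pred V.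
Proof.
rewrite gclass0; split=> [h|vt]; last exact: sub_gen.
suff : [set v | v \in torsion_pred V] v by [].
by apply: h; split=> //; split=> [|x y]; [apply: rpred0|apply: rpredB].
Qed.

Lemma red_torsion_free (x : Vr) : x \in torsion_pred Vr -> x = 0.
Proof.
move=> /torsion_predP[k k0]; rewrite -[x]greprK -raddfMn => /red_class0/torsion_predP[l l0 h].
apply/red_class0/torsion_predP; exists (k * l)%N; first by rewrite muln_gt0 k0.
by rewrite mulrnA.
Qed.

Lemma red_sum A (c : 'I_n -> int) :
  cl (\sum_(i in A) z i *~ c i) = \sum_(i in A) zr i *~ c i.
Proof. by rewrite (raddf_sum cl); apply: eq_bigr => i _; rewrite (raddfMz cl). Qed.

Lemma red_span A v : subgroup_gen [set zr i | i in [set` A]] (cl v) <->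
  exists2 t, t \in torsion_pred V & subgroup_gen [set z i | i in [set` A]] (v - t).
Proof.
rewrite subgroup_gen_sum; split=> [[c vc]|[t tt /subgroup_gen_sum[c vc]]].
  exists (v - \sum_(i in A) z i *~ c i); last by rewrite subKr; apply/subgroup_gen_sum; exists c.
  by apply/red_class0/gclass0/gclass_eq; rewrite vc -red_sum.
exists c; rewrite -red_sum -vc; apply/gclass_eq; rewrite subKr.
exact: sub_gen.
Qed.

Definition red_proj A (q : zquot z A) : zquot zr A := gclass _ (cl (grepr q)).

Lemma red_proj_gclass A v : red_proj (gclass _ v : zquot z A) = gclass _ (cl v).
Proof.
apply/gclass_eq; rewrite -raddfB; apply/red_span; exists 0; first exact: rpred0.
rewrite subr0; apply/gclass_eq; exact: greprK.
Qed.

Lemma red_proj_is_additive A : zmod_morphism (@red_proj A).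
Proof.
move=> x y; rewrite -[x]greprK -[y]greprK -(raddfB (gclass _)) !red_proj_gclass.
by rewrite !raddfB.
Qed.

HB.instance Definition _ A := GRing.isZmodMorphism.Build (zquot z A) (zquot zr A)
  (@red_proj A) (@red_proj_is_additive A).

Lemma red_proj_surj A (w : zquot zr A) : exists q : zquot z A, red_proj q = w.
Proof. by exists (gclass _ (grepr (grepr w))); rewrite red_proj_gclass !greprK. Qed.

(** Exactness in the middle of tors(V) -> M(A) -> M'(A) -> 0. *)
Lemma red_proj_ker A (q : zquot z A) : red_proj q = 0 ->
  exists t : torsion V, q = gclass _ (torsion_val t).
Proof.
rewrite -[q]greprK red_proj_gclass => /gclass0/red_span[t tt h].
by exists (Torsion tt) => /=; apply/gclass_eq.
Qed.

Lemma red_proj_torsion A (t : torsion V) : red_proj (gclass _ (torsion_val t) : zquot z A) = 0.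
Proof.
case: t => t tt; rewrite red_proj_gclass /=.
by rewrite (_ : cl t = 0) ?raddf0 //; apply/red_class0.
Qed.

Lemma red_zrank : zrank Vr = zrank V.
Proof.
apply/esym; apply: (zrank_torsion_quot (h := cl) fgV) => [w|v /red_class0//].
by exists (grepr w); apply: greprK.
Qed.

Lemma gclass_torsion S (t : torsion V) : gclass S (torsion_val t) \in torsion_pred (gquot S).
Proof.
case: t => t /= /torsion_predP[k k0 kt]; apply/torsion_predP; exists k => //.
by rewrite -raddfMn kt raddf0.
Qed.

Lemma red_zquot_zrank A : zrank (zquot zr A) = zrank (zquot z A).
Proof.
apply/esym; apply: (zrank_torsion_quot (h := @red_proj A)).
- exact: fin_gen_gquot.
- exact: red_proj_surj.
by move=> q /red_proj_ker[t ->]; apply: gclass_torsion.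
Qed.

Definition indep A : bool := (zrank V - zrank (zquot z A) == #|A|)%N.

Lemma indepS A B : A \subset B -> indep B -> indep A.
Proof.
have [p] := presentation_exists z fgV; exact: (pres_indepS p).
Qed.

(* Otherwise some z_b is torsion modulo the other generators, and adding it
   does not change the rank. *)
Lemma indep_torsion_span A v : indep A -> v \in torsion_pred V ->
  subgroup_gen [set z i | i in [set` A]] v -> v = 0.
Proof.
move=> iA /torsion_predP[k k0 kv] /subgroup_gen_sum[c vc].
have c0 b : b \in A -> c b = 0.
  move=> bA; apply/eqP; apply: contraT => cb.
  have iA' : indep (A :\ b) by apply: indepS iA; apply: finset.subD1set.
  suff zz : zrank (zquot z (A :\ b)) = zrank (zquot z A).
    by move: iA iA'; rewrite /indep zz (cardsD1 b A) bA => /eqP -> /eqP; lia.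
  have AE : b |: A :\ b = A by apply: finset.setD1K.
  rewrite -[X in _ = zrank (zquot z X)]AE.
  apply: (zrank_torsion_quot (h := @zproj n V z (A :\ b) b)).
  - exact: fin_gen_gquot.
  - move=> w; exists (gclass _ (grepr w)); apply: etrans (@zproj_gclass n V z (A :\ b) b _) _.
    exact: greprK.
  move=> q; rewrite -[q]greprK => /(etrans (esym (@zproj_gclass n V z (A :\ b) b _))).
  move=> /gclass0/subgroup_gen_sum[e]; rewrite AE => qe.
  apply/torsion_predP; exists (k * `|c b|)%N; first by rewrite muln_gt0 k0 absz_gt0.
  rewrite -raddfMn; apply/gclass0/subgroup_gen_sum.
  (* Elimination of z_b: the relation for [q] is multiplied by [K], and [v *~ s], which is 0, is
     subtracted. The factor [s] is chosen so that e_b K = c_b s, since c_b times its sign is its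
     absolute value. *)
  pose K : int := (k * `|c b|)%N; pose s : int := k%:Z * (e b * Num.sg (c b)).
  exists (fun i => e i * K - c i * s).
  have vs : v *~ s = 0 by rewrite mulrzA -pmulrn kv mul0rz.
  transitivity (grepr q *~ K - v *~ s); first by rewrite vs subr0 pmulrn.
  rewrite qe vc !mulrz_suml -sumrB (bigD1 b) //=.
  rewrite -!mulrzA -mulrzBr (_ : e b * K - c b * s = 0) ?mulr0z ?add0r.
    apply: eq_big => [i|i _]; first by rewrite !inE andbC.
    by rewrite -!mulrzA -mulrzBr.
  rewrite /K /s PoszM; have -> : (`|c b|%N : int) = Num.sg (c b) * c b by rewrite abszE normrEsg.
  by ring.
by rewrite vc big1 // => i /c0 ->.
Qed.

End ReducedGroup.

(** The torsion groups form a short exact sequence 0 -> tors(V) -> tors(M(A)) -> tors(M'(A)) -> 0.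
    Injectivity is [indep_torsion_span]; surjectivity holds because the kernel of M(A) -> M'(A) is
    torsion, so preimages of torsion elements are torsion. A set-theoretic section then gives the
    bijection that counts. *)
Lemma tcard_red (n : nat) (V : zmodType) (z : 'I_n -> V) (A : {set 'I_n}) :
  fin_gen V -> indep z A ->
  tcard (zquot z A) = (tcard V * tcard (zquot (red_vec z) A))%N.
Proof.
move=> fgV iA; have fgr : fin_gen (zquot (red_vec z) A) by do 2 apply: fin_gen_gquot.
have [I1 [f1 [b1 <-]]] := fg_torsion_fin fgV.
have [I2 [f2 [b2 <-]]] := fg_torsion_fin fgr.
pose i (t : torsion V) : torsion (zquot z A) := torsion_map (gclass _) t.
have ii : injective i.
  move=> t t' /(congr1 (@torsion_val _)) /= /gclass_eq h; apply: val_inj.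
  apply/eqP; rewrite -subr_eq0 -raddfB; apply/eqP; apply: (indep_torsion_span fgV iA).
    by case: (t - t').
  by rewrite raddfB.
have sx (x : torsion (zquot (red_vec z) A)) :
    exists y : torsion (zquot z A), torsion_map (@red_proj n V z A) y = x.
  case: x => x xt; have [q qx] := red_proj_surj x.
  suff qt : q \in torsion_pred (zquot z A) by exists (Torsion qt); apply: val_inj.
  move/torsion_predP: xt => [k k0]; rewrite -qx -raddfMn => /red_proj_ker[t qt].
  have /torsion_predP[l l0 h] := gclass_torsion [set z i | i in [set` A]] t.
  apply/torsion_predP; exists (k * l)%N; first by rewrite muln_gt0 k0.
  by rewrite mulrnA qt h.
pose s x := sval (cid (sx x)).
have sE x : torsion_map (@red_proj n V z A) (s x) = x by rewrite /s; case: cid.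
have pi0 t : torsion_map (@red_proj n V z A) (i t) = 0.
  by apply: val_inj => /=; apply: red_proj_torsion.
pose F (x : I1 * I2) := i (f1 x.1) + s (f2 x.2).
rewrite -card_prod; apply: (card_fset_setT_fin (f := F)).
have Fpi x : torsion_map (@red_proj n V z A) (F x) = f2 x.2.
  apply: etrans (raddfD _ _ _) _; exact: etrans (congr2 +%R (pi0 _) (sE _)) (add0r _).
have Fi : injective F.
  move=> [a b] [a' b'] ab; have bb : b = b'.
    by apply: (bij_inj b2); rewrite -[LHS](Fpi (a, b)) ab Fpi.
  by move: ab; rewrite /F bb => /addIr/ii/(bij_inj b1) /= ->.
have Fs y : exists x, F x = y.
  have [g2 _ fg2] := b2; have [g1 _ fg1] := b1.
  pose x := torsion_map (@red_proj n V z A) y.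
  have /(congr1 (@torsion_val _)) /red_proj_ker[t tE] :
      torsion_map (@red_proj n V z A) (y - s x) = 0.
    apply: etrans (raddfB _ _ _) _; exact: etrans (congr2 (fun a b => a - b) (erefl x) (sE x)) (subrr _).
  exists (g1 t, g2 x); rewrite /F /= fg1 fg2; apply/eqP; rewrite eq_sym -subr_eq; apply/eqP.
  exact: val_inj.
exists (fun y => sval (cid (Fs y))) => [x|y]; last by case: cid.
by apply: Fi; case: cid.
Qed.

Lemma tcard_free (V : zmodType) (a : nat) : tcard (V * 'rV[int]_a)%type = tcard V.
Proof.
apply/esym; have tv (t : torsion V) : (torsion_val t, 0) \in torsion_pred (V * 'rV[int]_a)%type.
  case: t => t /= /torsion_predP[k k0 kt]; apply/torsion_predP; exists k => //.
  have -> : forall l, ((t, 0) : V * 'rV[int]_a) *+ l = (t *+ l, 0).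
    by elim=> // l IH; rewrite !mulrS IH; congr pair; rewrite addr0.
  by rewrite kt.
have tw (x : torsion (V * 'rV[int]_a)%type) :
    (torsion_val x).1 \in torsion_pred V /\ (torsion_val x).2 = 0.
  case: x => -[v w] /= /torsion_predP[k k0].
  have -> : forall l, ((v, w) : V * 'rV[int]_a) *+ l = (v *+ l, w *+ l).
    by elim=> // l IH; rewrite !mulrS IH.
  move=> kvw; have kv := congr1 fst kvw; have kw := congr1 snd kvw.
  split; first by apply/torsion_predP; exists k.
  apply/rowP => j; move/rowP/(_ j): kw; rewrite mulmxnE !mxE => /eqP.
  by rewrite mulrn_eq0 gtn_eqF //= => /eqP.
apply: (card_fset_setT_bij (f := fun t => Torsion (tv t))).
exists (fun x => Torsion (tw x).1) => [t|x]; apply: val_inj => //=.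
by have [_ <-] := tw x; rewrite -surjective_pairing.
Qed.

Lemma zrank_free (V : zmodType) (a : nat) : fin_gen V ->
  zrank (V * 'rV[int]_a)%type = (zrank V + a)%N.
Proof.
move=> /fg_structure[G [f bf]]; apply: (@zrankE _ _ G); have [g fg gf] := bf.
pose h (x : V * 'rV[int]_a) : 'rV[int]_(zrank V + a) * G := (row_mx (f x.1).1 x.2, (f x.1).2).
have ha : zmod_morphism h.
  by move=> x y; rewrite /h /= raddfB; congr pair; rewrite /= opp_row_mx add_row_mx.
pose hM := GRing.isZmodMorphism.Build _ _ h ha.
pose H : {additive (V * 'rV[int]_a)%type -> ('rV[int]_(zrank V + a) * G)%type} := HB.pack h hM.
exists H; exists (fun y => (g (lsubmx y.1, y.2), rsubmx y.1)) => [[x w]|[u y]] /=; rewrite /h /=.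
  by rewrite row_mxKl row_mxKr -surjective_pairing fg.
by rewrite gf /= hsubmxK.
Qed.

Lemma rows_span a b (B : 'M[int]_(a, b)) w : subgroup_gen [set row i B | i in setT] w <->
  exists c : 'rV[int]_a, w = c *m B.
Proof.
split=> [|[c ->]].
  move: w; apply: gen_min => [|_ [i _ <-]]; last by exists (delta_mx 0 i); rewrite rowE.
  split; first by exists 0; rewrite mul0mx.
  by move=> _ _ [c ->] [c' ->]; exists (c - c'); rewrite mulmxBl.
rewrite mulmx_sum_row; under eq_bigr do rewrite -[c _ _]intz scaler_int.
by apply: (is_subgroup_sumz _ _ (subgroup_genP _)) => i; apply: sub_gen; exists i.
Qed.

(** * The Gale dual *)

Section Dual.
Variables (n : nat) (V : zmodType) (z : 'I_n -> V) (p : presentation z).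
Local Notation m := (pres_gens p).
Local Notation k := (pres_rels p).
Implicit Types A : {set 'I_n}.

Let e (i : 'I_n) : 'rV[int]_(n + k) := delta_mx 0 (lshift k i).

Lemma dual_span A u :
  subgroup_gen [set dual_vec p i | i in [set` A]] (gclass [set row i (dual_mx p) | i in setT] u)
  <-> exists (c : 'rV[int]_m) (b : 'I_n -> int),
        u = c *m dual_mx p + \sum_(i in A) e i *~ b i.
Proof.
have rowsE := rows_span (dual_mx p).
rewrite subgroup_gen_sum; set cl := gclass _.
have clE (b : 'I_n -> int) : cl (\sum_(i in A) e i *~ b i) = \sum_(i in A) dual_vec p i *~ b i.
  apply: etrans (raddf_sum cl _ _ _) _; apply: eq_bigr => i _; exact: (raddfMz cl).
split=> [[b]|[c [b ->]]].
  by rewrite -clE => /gclass_eq/rowsE[c uc]; exists c, b; rewrite -uc subrK.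
by exists b; rewrite -clE; apply/gclass_eq/rowsE; exists c; rewrite addrK.
Qed.

Lemma tr_sub_mx_entry A (c : 'rV[int]_m) j :
  (c *m (sub_mx p (~: A))^T) 0 j =
  if fintype.split j is inl i then if i \in A then 0 else (c *m dual_mx p) 0 j
  else (c *m dual_mx p) 0 j.
Proof.
rewrite !mxE /dual_mx /sub_mx; case: fintype.splitP => i ji.
  have -> : j = lshift k i by apply: val_inj.
  case: ifPn => iA; last first.
    apply: eq_bigr => l _; rewrite ![_^T _ _]mxE !col_mxEu; congr (_ * _).
    by rewrite /sub_lift mxE inE iA mxE.
  rewrite big1 // => l _; rewrite [_^T _ _]mxE col_mxEu /sub_lift mxE inE iA mxE mulr0 //.
have -> : j = rshift n i by apply: val_inj.
by apply: eq_bigr => l _; rewrite ![_^T _ _]mxE !col_mxEd.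
Qed.

(** Both sides are quotients of Z^(n + k). Zeroing the columns indexed by [A] leaves the
    corresponding basis vectors free, whereas the dual quotient kills them; the difference is
    exactly one copy of Z for each element of [A]. *)
Lemma dual_isog A : isog (gquot [set row i (sub_mx p (~: A))^T | i in setT])
  (zquot (dual_vec p) A * 'rV[int]_#|A|)%type.
Proof.
pose cl := gclass [set row i (dual_mx p) | i in setT].
pose phi (u : 'rV[int]_(n + k)) : zquot (dual_vec p) A * 'rV[int]_#|A| :=
  (gclass _ (cl u), \row_j u 0 (lshift k (enum_val j))).
have pa : zmod_morphism phi.
  move=> u v; rewrite /phi /cl !raddfB; congr pair.
  by apply/rowP => j; rewrite !mxE.
pose pM := GRing.isZmodMorphism.Build _ _ phi pa.
pose Phi : {additive 'rV[int]_(n + k) -> (zquot (dual_vec p) A * 'rV[int]_#|A|)%type} := HB.pack phi pM.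
have eE i (b : 'I_n -> int) : (\sum_(i in A) e i *~ b i) 0 (lshift k i) = if i \in A then b i else 0.
  rewrite summxE; case: ifPn => iA.
    rewrite (bigD1 i) //= -scaler_int intz !mxE !eqxx mulr1 big1 ?addr0 // => j /andP[_ ji].
    by rewrite -scaler_int !mxE eqxx (inj_eq (@lshift_inj _ _)) eq_sym (negbTE ji) mulr0.
  rewrite big1 // => j jA; rewrite -scaler_int !mxE eqxx (inj_eq (@lshift_inj _ _)).
  by case: eqP => [ij|_]; rewrite ?mulr0 //; rewrite ij jA in iA.
have eE' i (b : 'I_n -> int) : (\sum_(i in A) e i *~ b i) 0 (rshift n i) = 0.
  by rewrite summxE big1 // => j _; rewrite -scaler_int !mxE eq_rlshift andbF mulr0.
apply: (isog_ker (f := Phi)) => [[q w]|u].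
  (* Any lift of [q] may be moved along the basis vectors indexed by [A] without changing its class;
     [b] is the move that gives it the coordinates prescribed by [w]. *)
  pose u0 := grepr (grepr q); pose b i := if pick (fun j => enum_val j == i) is Some j
    then w 0 j - u0 0 (lshift k i) else 0.
  exists (u0 + \sum_(i in A) e i *~ b i); rewrite /= /phi; congr pair.
    rewrite -[RHS]greprK; apply/gclass_eq.
    have -> : grepr q = cl u0 by rewrite /u0 /cl greprK.
    rewrite -raddfB addrAC subrr add0r; apply/dual_span; exists 0, b.
    by rewrite mul0mx add0r.
  apply/rowP => j; rewrite !mxE eE enum_valP /b; case: pickP => [j' /eqP/enum_val_inj ->|/(_ j)].
    by rewrite addrC subrK.
  by rewrite eqxx.
rewrite rows_span; split=> [pu|[c uc]].
  have /gclass0/dual_span[c [b ub]] := congr1 fst pu; have /rowP u0 := congr1 snd pu.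
  exists c; apply/rowP => j; rewrite tr_sub_mx_entry; case: fintype.splitP => i ji.
    have {ji} -> : j = lshift k i by apply: val_inj.
    case: ifPn => iA; first by have := u0 (enum_rank_in iA i); rewrite !mxE enum_rankK_in.
    by rewrite ub mxE eE (negbTE iA) addr0.
  have {ji} -> : j = rshift n i by apply: val_inj.
  by rewrite ub mxE eE' addr0.
rewrite /= /phi; congr pair; last first.
  apply/rowP => j; rewrite !mxE uc tr_sub_mx_entry.
  by rewrite (fintype.unsplitK (inl (enum_val j))) enum_valP.
apply/gclass0/dual_span; exists c, (fun i => - (c *m dual_mx p) 0 (lshift k i)).
apply/rowP => j; rewrite uc tr_sub_mx_entry [RHS]mxE -[j]fintype.splitK; case: (fintype.split j) => i /=.
  by rewrite (fintype.unsplitK (inl i)) eE; case: ifP; rewrite ?subrr ?addr0.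
by rewrite (fintype.unsplitK (inr i)) eE' addr0.
Qed.

Lemma sub_rank0 : sub_rank p finset.set0 = k.
Proof.
have fr : row_free (ratmx (pres_rel p)) by apply: ratmx_row_free; apply: pres_free.
apply/eqP; rewrite -[X in _ == X](eqP fr) eqn_leq; apply/andP; split; apply: mxrankS.
  rewrite map_col_mx col_mx_sub submx_refl andbT; apply/row_subP => i.
  by rewrite -map_row row_sub_lift finset.in_set0 map_mx0 sub0mx.
by rewrite map_col_mx -addsmxE addsmxSr.
Qed.

Lemma tr_sub_mx_cokernel A :
  cokernel_of (gclass [set row i (sub_mx p A)^T | i in setT]) (sub_mx p A)^T.
Proof.
split=> [q|u]; first by exists (grepr q); apply: greprK.
by rewrite gclass0; apply: rows_span.
Qed.

Lemma dual_tcard A : tcard (zquot (dual_vec p) A) = tcard (zquot z (~: A)).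
Proof.
rewrite -(tcard_free _ #|A|) -(tcard_isog (dual_isog A)).
apply/esym; apply: (cokernel_tr_tcard (sub_mx_cokernel p _) (tr_sub_mx_cokernel _)).
Qed.

Lemma dual_zrank A :
  (zrank (zquot (dual_vec p) A) + #|A| = n + k - sub_rank p (~: A))%N.
Proof.
rewrite -zrank_free; last by do 2 apply: fin_gen_gquot; apply: fin_gen_rV.
rewrite -(zrank_isog (dual_isog A)) (cokernel_zrank (tr_sub_mx_cokernel _)).
by rewrite -map_trmx mxrank_tr.
Qed.

End Dual.

(** * The poset of torsions *)

Section TorsionPoset.
Variables (R : realType) (n : nat) (W : zmodType) (y : 'I_n -> W).
Hypotheses (fgW : fin_gen W) (tfW : forall v : W, v \in torsion_pred W -> v = 0).
Implicit Types A B : {set 'I_n}.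

Local Notation gen A := [set y i | i in [set` A]].
Local Notation G := (Gr R y).
Implicit Types x : G.

Definition tors_mod A (v : W) : bool := gclass (gen A) v \in torsion_pred (zquot y A).

Lemma gen_sub A B v : A \subset B -> subgroup_gen (gen A) v -> subgroup_gen (gen B) v.
Proof.
move=> AB; move: v; apply: gen_min; first exact: subgroup_genP.
by move=> _ [i iA <-]; apply: sub_gen; exists i => //; apply: (fintype.subsetP AB).
Qed.

Lemma tors_modS A B v : A \subset B -> tors_mod A v -> tors_mod B v.
Proof.
move=> AB /torsion_predP[k k0 kv]; apply/torsion_predP; exists k => //.
by move: kv; rewrite -!raddfMn => /gclass0 kv; apply/gclass0; apply: gen_sub kv.
Qed.

(* Characters of the different groups M(A) are compared as functions on W,
   extended by 0 off the elements that are torsion modulo A. *)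
Definition gr_fun (x : G) (v : W) : R[i] :=
  match @idP (tors_mod (gr_set x) v) with
  | ReflectT h => gr_char x (Torsion h)
  | ReflectF _ => 0
  end.

Lemma gr_funE x v (h : tors_mod (gr_set x) v) : gr_fun x v = gr_char x (Torsion h).
Proof. by rewrite /gr_fun; case: {-}_ / idP => // h'; congr (gr_char x _); apply: val_inj. Qed.

Lemma gr_fun_eq0 x v : (gr_fun x v == 0) = ~~ tors_mod (gr_set x) v.
Proof.
apply/idP/idP => [|nt]; last by rewrite /gr_fun; case: {-}_ / idP => // h; rewrite h in nt.
by apply: contraL => h; rewrite (gr_funE h) char_neq0.
Qed.

Lemma gr_funD x u v : tors_mod (gr_set x) u -> tors_mod (gr_set x) v ->
  gr_fun x (u + v) = gr_fun x u * gr_fun x v.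
Proof.
move=> hu hv; have huv : tors_mod (gr_set x) (u + v).
  by rewrite /tors_mod raddfD; apply: rpredD.
rewrite !gr_funE -charD; congr (gr_char x _); apply: val_inj => /=.
exact: raddfD.
Qed.

Lemma gr_fun_class x u v : subgroup_gen (gen (gr_set x)) (u - v) -> gr_fun x u = gr_fun x v.
Proof.
move=> /gclass_eq uv; have [hv|hv] := boolP (tors_mod (gr_set x) v); last first.
  have hu : ~~ tors_mod (gr_set x) u by rewrite /tors_mod uv.
  by move: hu hv; rewrite -!gr_fun_eq0 => /eqP -> /eqP ->.
have hu : tors_mod (gr_set x) u by rewrite /tors_mod uv.
by rewrite !gr_funE; congr (gr_char x _); apply: val_inj.
Qed.

Lemma tors_mod_repr A (t : torsion (zquot y A)) : tors_mod A (grepr (torsion_val t)).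
Proof. by rewrite /tors_mod greprK; case: t. Qed.

Lemma gr_ext x1 x2 : gr_set x1 = gr_set x2 -> (forall v, gr_fun x1 v = gr_fun x2 v) -> x1 = x2.
Proof.
case: x1 x2 => [A iA l] [B iB h] /= AB; case: B / AB iB h => iB h lh.
have -> : iB = iA by apply: Prop_irrelevance.
congr MkGr; apply: char_inj => t; have tt := tors_mod_repr t.
have tE : t = Torsion tt by apply: val_inj; rewrite /= greprK.
by have := lh (grepr (torsion_val t)); rewrite !gr_funE /= -tE.
Qed.

Lemma gr_indepS x A : A \subset gr_set x -> (zrank W - zrank (zquot y A))%N = #|A|.
Proof.
move=> AB; apply/eqP; apply: (indepS fgW AB); apply/eqP; exact: gr_indep.
Qed.

Section Restriction.
Variables (x : G) (A : {set 'I_n}) (AB : A \subset gr_set x).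

Definition rs_fun (t : torsion (zquot y A)) : R[i] := gr_fun x (grepr (torsion_val t)).

Let tm t : tors_mod (gr_set x) (grepr (torsion_val (t : torsion (zquot y A)))).
Proof. exact: tors_modS AB (tors_mod_repr t). Qed.

Lemma rs_fun_neq0 t : rs_fun t != 0.
Proof. by rewrite /rs_fun gr_fun_eq0 negbK. Qed.

Lemma rs_funD t1 t2 : rs_fun (t1 + t2) = rs_fun t1 * rs_fun t2.
Proof.
rewrite /rs_fun -gr_funD //; apply: gr_fun_class; apply: (gen_sub AB).
apply/gclass_eq; apply: etrans (greprK _) _; apply: etrans _ (esym (raddfD _ _ _)).
apply: etrans (raddfD val t1 t2) _; apply: congr2; exact: esym (greprK _).
Qed.

Definition rs_gr : G := MkGr (gr_indepS AB) (Character rs_fun_neq0 rs_funD).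

Lemma rs_gr_fun v : tors_mod A v -> gr_fun rs_gr v = gr_fun x v.
Proof.
move=> hv; rewrite (gr_funE (x := rs_gr) hv) /= /rs_fun /=; apply: gr_fun_class.
by apply: (gen_sub AB); apply/gclass_eq; rewrite greprK.
Qed.

End Restriction.

(** The branch is needed because the restricted element contains a proof of independence, inherited
    from [gr_set x]. Off its subsets the value [x] is a mere default. *)
Definition gr_restrict (x : G) A : G :=
  match @idP (A \subset gr_set x) with
  | ReflectT h => rs_gr h
  | ReflectF _ => x
  end.

Lemma gr_restrict_set x A : A \subset gr_set x -> gr_set (gr_restrict x A) = A.
Proof. by rewrite /gr_restrict; case: {-}_ / idP. Qed.

Lemma gr_restrict_fun x A v : A \subset gr_set x -> tors_mod A v ->
  gr_fun (gr_restrict x A) v = gr_fun x v.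
Proof. by rewrite /gr_restrict; case: {-}_ / idP => // h _; apply: rs_gr_fun. Qed.

(** The order without closure: [gr_le] is a chain of coverings, whereas this compares its two ends
    directly. *)
Definition gr_sub (x1 x2 : G) : Prop := gr_set x1 \subset gr_set x2 /\
  forall v, tors_mod (gr_set x1) v -> gr_fun x1 v = gr_fun x2 v.

Lemma gr_sub_trans x1 x2 x3 : gr_sub x1 x2 -> gr_sub x2 x3 -> gr_sub x1 x3.
Proof.
move=> [s12 f12] [s23 f23]; split; first exact: fintype.subset_trans s23.
by move=> v hv; rewrite f12 // f23 //; apply: tors_modS hv.
Qed.

Lemma gr_restrict_sub x A : A \subset gr_set x -> gr_sub (gr_restrict x A) x.
Proof.
move=> AB; split; first by rewrite gr_restrict_set.
by rewrite gr_restrict_set // => v; apply: gr_restrict_fun.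
Qed.

Lemma gr_sub_eq x1 x2 : gr_sub x1 x2 -> gr_set x1 = gr_set x2 -> x1 = x2.
Proof.
move=> [_ f12] s12; apply: gr_ext => // v.
have [/f12//|nt] := boolP (tors_mod (gr_set x1) v).
by move: (nt); rewrite -gr_fun_eq0 => /eqP ->; move: nt; rewrite s12 -gr_fun_eq0 => /eqP ->.
Qed.

Lemma gr_subP x1 x2 : gr_sub x1 x2 <->
  gr_set x1 \subset gr_set x2 /\ gr_restrict x2 (gr_set x1) = x1.
Proof.
split=> [x12|[s12 rE]]; last by rewrite -rE; apply: gr_restrict_sub.
have [s12 f12] := x12; split=> //; apply/esym/gr_sub_eq; last by rewrite gr_restrict_set.
split; first by rewrite gr_restrict_set.
by move=> v hv; rewrite gr_restrict_fun // f12.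
Qed.

Lemma gr_covers_sub x1 x2 : gr_covers x1 x2 -> gr_sub x1 x2.
Proof.
case=> A b iA iAb l h bA <-; split; first exact: finset.subsetUr.
move=> v hv; have hv' : tors_mod (b |: A) v.
  by apply: tors_modS hv; apply: finset.subsetUr.
rewrite (gr_funE (x := MkGr iA _) hv) (gr_funE (x := MkGr iAb h) hv') /=; congr (h _).
by apply: val_inj => /=; apply: zproj_gclass.
Qed.

Lemma gr_sub_covers x1 x2 b : b \notin gr_set x1 -> gr_set x2 = b |: gr_set x1 ->
  gr_sub x1 x2 -> gr_covers x1 x2.
Proof.
case: x1 x2 => [A iA l] [B iB h] /= bA BE [_ f12]; subst B.
apply: GrCovers => //; apply: char_inj => t; have tt := tors_mod_repr t.
have tE : t = Torsion tt by apply: val_inj; rewrite /= greprK.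
have tt' : tors_mod (b |: A) (grepr (torsion_val t)).
  by apply: tors_modS (tt); apply: finset.subsetUr.
have := f12 _ tt; rewrite (gr_funE (x := MkGr iA l) tt) (gr_funE (x := MkGr iB h) tt') /=.
rewrite -tE => ->; congr (h _); apply: val_inj => /=; exact: erefl.
Qed.

(** A chain is rebuilt from its ends by induction on the number of missing elements: restricting
    [x2] to the set of [x1] with one more element gives a cover of [x1] that still lies below
    [x2]. *)
Lemma gr_leP x1 x2 : gr_le x1 x2 <-> gr_sub x1 x2.
Proof.
split=> [|x12].
  elim=> [u v|u|u v w _ uv _ vw]; [exact: gr_covers_sub|by split|exact: gr_sub_trans vw].
have [k] := ubnP #|gr_set x2 :\: gr_set x1|; elim: k x1 x12 => // k IH x1 x12.
have [s12 f12] := x12; have [D0|[b]] := set_0Vmem (gr_set x2 :\: gr_set x1).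
  move=> _; have <- : x1 = x2; last exact: rt_refl.
  apply: (gr_sub_eq x12); apply/eqP; rewrite finset.eqEsubset s12 /=.
  by rewrite -finset.setD_eq0 D0.
rewrite inE => /andP[b1 b2] lk.
have bs : b |: gr_set x1 \subset gr_set x2 by rewrite finset.subUset finset.sub1set b2.
pose x3 := gr_restrict x2 (b |: gr_set x1).
have x13 : gr_sub x1 x3.
  split; first by rewrite gr_restrict_set ?finset.subsetUr.
  move=> v hv; rewrite gr_restrict_fun //; first exact: f12.
  by apply: tors_modS hv; apply: finset.subsetUr.
apply: rt_trans (rt_step _ _ _ _ (gr_sub_covers b1 _ x13)) _; first exact: gr_restrict_set.
apply: IH; first exact: gr_restrict_sub.
rewrite gr_restrict_set // -ltnS; apply: leq_trans lk; rewrite ltnS; apply: proper_card.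
apply/properP; split; first by apply: finset.setDS; apply: finset.subsetUr.
by exists b; rewrite !inE ?eqxx ?b1.
Qed.

Lemma gr_fiber0 A : ~~ indep y A -> [set x : {classic G} | gr_set x = A] = set0.
Proof.
move=> iA; apply/seteqP; split=> // x /= xA; case/negP: iA; rewrite -xA /indep.
by apply/eqP; apply: gr_indep.
Qed.

Lemma gr_fiber A : indep y A -> exists (I : finType) (F : I -> {classic G}),
  [/\ injective F, [set x : {classic G} | gr_set x = A] = F @` [set: I] &
      #|I| = tcard (zquot y A)].
Proof.
move=> iA; have [I [f [[g fg gf] cI]]] := fg_char_fin R (fin_gen_gquot (gen A) fgW).
exists I, (fun i => MkGr (eqP iA) (f i)); split=> //.
  move=> i j /(congr1 gr_fun) ij; apply: (can_inj fg); apply: char_inj => t.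
  have tt := tors_mod_repr t.
  have tE : t = Torsion tt by apply: val_inj; rewrite /= greprK.
  have := congr1 (fun h => h (grepr (torsion_val t))) ij.
  by rewrite (gr_funE (x := MkGr (eqP iA) (f i)) tt)
             (gr_funE (x := MkGr (eqP iA) (f j)) tt) /= -tE.
apply/seteqP; split=> [[B iB l] /= BA|_ [i _ <-] //].
subst B; exists (g l) => //; rewrite gf.
by congr MkGr; apply: Prop_irrelevance.
Qed.

Lemma gr_fiber_card A : #|` fset_set [set x : {classic G} | gr_set x = A]| =
  if indep y A then tcard (zquot y A) else 0%N.
Proof.
case: ifPn => iA; last by rewrite gr_fiber0 // fset_set0 cardfs0.
have [I [F [Fi -> <-]]] := gr_fiber iA; rewrite fset_set_image ?card_imfset //=.
exact: (card_fset_setT_fin (f := @id I) (Bijective (g := id) _ _)).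
Qed.

Lemma gr_fiber_finite A : finite_set [set x : {classic G} | gr_set x = A].
Proof.
have [iA|/gr_fiber0 -> //] := boolP (indep y A).
by have [I [F [_ -> _]]] := gr_fiber iA; apply: finite_image.
Qed.

Lemma tors_mod0 v : tors_mod finset.set0 v -> v = 0.
Proof.
move=> /torsion_predP[k k0]; rewrite -raddfMn => /gclass0/subgroup_gen_sum[c].
by rewrite big_set0 => kv; apply: tfW; apply/torsion_predP; exists k.
Qed.

Lemma gr_labelling :
  simplicial_labelling (P := {classic G}) (@gr_le R n W y) (@gr_set R n W y) gr_restrict.
Proof.
split.
- have -> : [set: {classic G}] = \bigcup_(A in [set: {set 'I_n}]) [set x | gr_set x = A].
    by apply/seteqP; split=> // x _; exists (gr_set x).
  by apply: bigcup_finite => // A _; apply: gr_fiber_finite.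
- by move=> s t; rewrite gr_leP gr_subP.
- exact: gr_restrict_set.
- by move=> t; apply: gr_sub_eq; rewrite ?gr_restrict_set //; apply: gr_restrict_sub.
- move=> t A B AB Bt; have At := fintype.subset_trans AB Bt.
  have Br : A \subset gr_set (gr_restrict t B) by rewrite gr_restrict_set.
  apply: gr_sub_eq; last by rewrite !gr_restrict_set.
  split; first by rewrite !gr_restrict_set.
  rewrite !gr_restrict_set // => v hv; rewrite !gr_restrict_fun //.
  exact: tors_modS hv.
- have i0 : (zrank W - zrank (zquot y finset.set0))%N = #|(finset.set0 : {set 'I_n})|.
    by rewrite -(zrank_isog (zquot0_isog y)) subnn cards0.
  have c1 (t : torsion (zquot y finset.set0)) : (1 : R[i]) != 0 by apply: oner_neq0.
  have c2 (t1 t2 : torsion (zquot y finset.set0)) : (1 : R[i]) = 1 * 1 by rewrite mulr1.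
  by exists (MkGr i0 (Character c1 c2)).
(* The bottom is unique because [W] is torsion-free: modulo the empty set only 0 is torsion, and
   there every character takes the value 1. *)
move=> s t s0 t0; apply: gr_ext; first by rewrite s0 t0.
have h x : gr_set x = finset.set0 -> gr_fun x 0 = 1.
  move=> x0; have h0 : tors_mod (gr_set x) 0 by rewrite /tors_mod raddf0; apply: rpred0.
  rewrite (gr_funE h0) -(char0 (gr_char x)); congr (gr_char x _).
  by apply: val_inj => /=; apply: raddf0.
move=> v; have [hv|hv] := boolP (tors_mod finset.set0 v).
  by rewrite (tors_mod0 hv) !h.
have := gr_fun_eq0 s v; have := gr_fun_eq0 t v.
by rewrite s0 t0 hv => /eqP -> /eqP ->.
Qed.

End TorsionPoset.

(** * The Hilbert series *)

Lemma realization_zrank (n : nat) (M : matroidZ n) (z : 'I_n -> M finset.set0)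
    (p : presentation z) (A : {set 'I_n}) :
  realization z -> zrank (M A) = (pres_gens p - sub_rank p A)%N.
Proof. by move=> rz; rewrite (zrank_isog (rz A)) (zquot_zrank p). Qed.

(** Here [g] and [k] count generators and relations, [i] and [c] are the sizes of I and its
    complement, [s] and [sT] the presentation ranks of I and of the ground set, and [a] is the free
    rank of the dual group at the complement. Independence gives s = k + i, hence a = 0, and both
    sides are sT - k - i. *)
Lemma dual_exponent (n k g i c s sT a : nat) :
  (k <= s)%N -> (s <= sT)%N -> (s <= k + i)%N -> (sT <= s + c)%N -> (sT <= g)%N ->
  (i + c = n)%N -> (a + c = n + k - s)%N -> (g - k - (g - s) = i)%N ->
  (c - (n + k - sT - a) = g - k - (g - sT) - i)%N.
Proof.
move=> h1 h2 h3 h4 h5 h6 h7 h8.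
have sE : s = (k + i)%N by lia.
have a0 : a = 0%N by lia.
by subst a s n; lia.
Qed.

(** [is_dual] brings a realization of its own, which may differ from any fixed one. This does no
    harm, because the right-hand side only involves coranks and torsion orders of [M]. *)
Lemma tutte_dual (n : nat) (M N : matroidZ n) (K : comNzRingType) (y : K) : is_dual M N ->
  tutte N 1 y = \sum_(I : {set 'I_n} | mcork M I == #|I|)
    (tcard (M I))%:R * (y - 1) ^+ (mrank M - #|I|).
Proof.
move=> [z [p [rz Nd]]]; rewrite /tutte.
rewrite (reindex_inj (@finset.setC_inj 'I_n)) [RHS]big_mkcond /=; apply: eq_bigr => I _.
have tE : tcard (N (~: I)) = tcard (M I).
  by rewrite (tcard_isog (Nd _)) dual_tcard finset.setCK -(tcard_isog (rz I)).
have zN A : (zrank (N A) + #|A| = n + pres_rels p - sub_rank p (~: A))%N.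
  by rewrite (zrank_isog (Nd A)) dual_zrank.
have zM := realization_zrank p ^~ rz.
have zN0 := zN finset.set0; have zNT := zN [set: 'I_n]%SET; have zNI := zN (~: I).
rewrite finset.setC0 cards0 in zN0; rewrite finset.setCT cardsT card_ord in zNT.
rewrite finset.setCK in zNI; have zM0 := zM finset.set0.
have zMT := zM [set: 'I_n]%SET; have zMI := zM I.
rewrite (sub_rank0 p) in zNT zM0.
have r1 := sub_rankS p (finset.sub0set I); have r2 := sub_rankS p (finset.subsetT I).
have r3 := sub_rank_card p (finset.sub0set I); have r4 := sub_rank_card p (finset.subsetT I).
have r5 := sub_rank_leq p [set: 'I_n]%SET.
rewrite finset.setTD in r4; rewrite finset.setD0 in r3; rewrite (sub_rank0 p) in r1 r3.
have cI := cardsC I; rewrite card_ord in cI.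
(* As x - 1 = 0, its power is the indicator of a zero exponent, that is of full dual corank at the
   complement of [I]; the rank count identifies this with independence of [I]. *)
rewrite tE subrr expr0n /mrank /mcork.
have -> : ((zrank (N finset.set0) - zrank (N [set: 'I_n]%SET) -
           (zrank (N finset.set0) - zrank (N (~: I))))%N == 0%N) =
          (zrank (M finset.set0) - zrank (M I) == #|I|)%N.
  by apply/eqP/eqP; lia.
case: eqP => [iI|_]; last by rewrite mulr0 mul0r.
rewrite mulr1; congr (_ * _ ^+ _); rewrite zM0 zMT.
rewrite zM0 zMI in iI; rewrite addn0 in zN0; rewrite zN0.
exact: (dual_exponent r1 r2 r3 r4 r5 cI zNI iI).
Qed.

Lemma has_dim_ffun (k : fieldType) (W : lmodType k) (U : set W) (N d : nat) :
  has_dim U d -> has_dim [set w : {ffun 'I_N -> W} | forall j, U (w j)] (N * d)%N.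
Proof.
move=> [b [bs bf]]; rewrite -[(N * d)%N](_ : #|{: 'I_N * 'I_d}| = _); last first.
  by rewrite card_prod !card_ord.
pose B (q : 'I_N * 'I_d) : {ffun 'I_N -> W} := [ffun i => if i == q.1 then b q.2 else 0].
have BE (c : 'I_N * 'I_d -> k) i :
    (\sum_q c q *: B q) i = \sum_(j < d) c (i, j) *: b j.
  pose H i' j : W := c (i', j) *: B (i', j) i.
  transitivity (\sum_q H q.1 q.2).
    by rewrite sum_ffunE; apply: eq_bigr => -[i' j] _; rewrite ffunE.
  rewrite -(pair_bigA _ H) /H /=.
  rewrite (bigD1 i) //= [X in _ + X]big1 ?addr0; last first.
    by move=> i' ii'; rewrite big1 // => j _; rewrite !ffunE eq_sym (negbTE ii') scaler0.
  by apply: eq_bigr => j _; rewrite !ffunE eqxx.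
apply: (has_dim_fin (b := B)) => [w|c c0 [i j]].
  split=> [Uw|[c ->] i]; last by rewrite BE; apply/bs; exists (fun j => c (i, j)).
  have ex i : exists c, w i = \sum_(j < d) c j *: b j by apply/bs.
  exists (fun q => sval (cid (ex q.1)) q.2); apply/ffunP => i; rewrite BE /=.
  by case: cid.
by apply: (bf (fun j => c (i, j))); rewrite -BE c0 ffunE.
Qed.

Lemma red_indep (n : nat) (V : zmodType) (z : 'I_n -> V) A :
  fin_gen V -> indep (red_vec z) A = indep z A.
Proof. by move=> fgV; rewrite /indep red_zrank // red_zquot_zrank. Qed.

Definition face_dim (n : nat) (V : zmodType) (z : 'I_n -> V) (R : realType) (i : nat) : nat :=
  (tcard V * #|face_index (@gr_set R n _ (red_vec z)
     : {classic Gr R (red_vec z)} -> {set 'I_n}) i|)%N.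

Lemma face_module_dim (k : fieldType) (R : realType) (n : nat) (V : zmodType)
    (z : 'I_n -> V) i : fin_gen V ->
  has_dim (face_module_comp k R z i) (face_dim z R i).
Proof.
move=> fgV; apply: has_dim_ffun; apply: face_comp_dim.
by apply: gr_labelling; [exact: fin_gen_gquot|exact: red_torsion_free].
Qed.

(** The [tcard V] copies of the face ring supply the factor by which the torsion of M(A) exceeds
    that of M'(A), by [tcard_red]. *)
Lemma face_dimE (R : realType) (n : nat) (V : zmodType) (z : 'I_n -> V) i : fin_gen V ->
  (face_dim z R i)%:R = \sum_(A | indep z A) (tcard (zquot z A))%:R * (pos_geom i ^+ #|A|)`_i.
Proof.
move=> fgV; have fgr : fin_gen (red_group V) by apply: fin_gen_gquot.
have lab := @gr_labelling R n _ (red_vec z) fgr (@red_torsion_free V).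
rewrite /face_dim natrM (card_face_index _ (slab_fin lab)) mulr_sumr [RHS]big_mkcond.
apply: eq_bigr => A _; rewrite (gr_fiber_card R _ fgr) red_indep // mulrA -natrM.
by case: (boolP (indep z A)) => iA; [rewrite (tcard_red fgV iA)|rewrite muln0 mul0r].
Qed.

Lemma realization_card_leq (n : nat) (M : matroidZ n) (z : 'I_n -> M finset.set0)
    (A : {set 'I_n}) : realization z -> mcork M A == #|A| -> (#|A| <= mrank M)%N.
Proof.
move=> rz /eqP <-; have [p] := presentation_exists z (mgroup_fg M _).
rewrite /mrank /mcork; apply: leq_sub2l; rewrite !(realization_zrank p) //.
by apply: leq_sub2l; apply: sub_rankS; apply: finset.subsetT.
Qed.

Lemma fraction_term (F : fieldType) (t : F) (r s : nat) : t != 0 -> (s <= r)%N ->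
  t ^+ r * (t^-1 - 1) ^+ (r - s) = t ^+ s * (1 - t) ^+ (r - s).
Proof.
move=> t0 sr; rewrite -{1}(subnKC sr) exprD -mulrA -exprMn mulrBr mulr1 mulfV //.
Qed.

Theorem theoremB (k : fieldType) (R : realType) (n : nat) (M Mdual : matroidZ n)
    (z : 'I_n -> M finset.set0) (r : nat) :
  essential M -> realization z -> mrank M = r -> is_dual M Mdual ->
  let t : {fraction {poly rat}} := tofrac 'X in
  hilbert_series (face_module_comp k R z)
    (t ^+ r / (1 - t) ^+ r * tutte Mdual 1 t^-1).
Proof.
move=> _ rz rM Md t; have fgV := mgroup_fg M finset.set0.
exists (face_dim z R); split; first by move=> i; apply: face_module_dim.
(* The numerator of (X / (1 - X))^#A over the common denominator (1 - X)^r, a polynomial because an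
   independent set has at most r elements. *)
pose term (A : {set 'I_n}) : {poly rat} := 'X^#|A| * (1 - 'X) ^+ (r - #|A|).
exists (\sum_(A | mcork M A == #|A|) (tcard (M A))%:R * term A), ((1 - 'X) ^+ r).
split.
- by rewrite horner_exp !hornerE ?oppr0 ?addr0 ?subr0 ?expr1n ?oner_neq0.
- rewrite (tutte_dual _ Md) rM rmorph_sum /= rmorphXn rmorphB rmorph1 /= -/t.
  rewrite mulrAC; congr (_ / _); rewrite mulr_sumr; apply: eq_bigr => A iA.
  have Ar : (#|A| <= r)%N by rewrite -rM; apply: realization_card_leq iA.
  have t0 : t != 0 by rewrite tofrac_eq0 polyX_eq0.
  rewrite mulrCA fraction_term // !rmorphM rmorph_nat !rmorphXn rmorphB rmorph1 //.
move=> i; rewrite coef_sum.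
under eq_bigr do rewrite face_dimE // mulr_sumr.
have iE A : indep z A = (mcork M A == #|A|) by rewrite /indep /mcork (zrank_isog (rz A)).
(* The product with (1 - X)^r is evaluated for each independent set separately, where
   [pos_geom_series] applies. *)
rewrite exchange_big /=; apply: eq_big => [A|A]; first exact: iE.
rewrite iE => iA.
rewrite mulr_natl coefMn -(pos_geom_series i (m := #|A|)); last first.
  by rewrite -rM; apply: realization_card_leq iA.
rewrite (tcard_isog (rz A)) -[RHS]mulr_natl mulr_sumr; apply: eq_bigr => j _.
by rewrite mulrCA.
Qed.
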